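(* Let $X$ be an infinite compact metric space and $\mathscr{V}=[V,p,X]$ a line bundle. Let $\mathcal{E}=\Gamma(\mathscr{V},\alpha)$ where $\alpha:X\to X$ is a minimal homeomorphism. Then $\mathcal{O}(\mathcal{E})$ is stably finite.
   Context: A homeomorphism $\alpha$ is minimal if every closed $E\subset X$ with $\alpha(E)\subset E$ is $\emptyset$ or $X$. A line bundle $\mathscr{V}=[V,p,X]$ over $X$ is a locally trivial complex vector bundle with one-dimensional fibres, equipped with a Hermitian structure (a continuous family of fibrewise inner products, linear in the second variable). $\Gamma(\mathscr{V})$ is the right Hilbert $C(X)$-module of continuous sections with $\langle\xi,\eta\rangle(x)=\langle\xi(x),\eta(x)\rangle$. $\Gamma(\mathscr{V},\alpha)$ is the $\mathrm{C}^*$-correspondence over $C(X)$ whose right Hilbert module is $\Gamma(\mathscr{V})$ and whose left action is $f\xi:=\xi\,(f\circ\alpha)$. A $\mathrm{C}^*$-correspondence over a $\mathrm{C}^*$-algebra $A$ is a right Hilbert $A$-module $\mathcal{E}$ with a $^*$-homomorphism $\varphi$ from $A$ to the adjointable operators $\mathcal{L}(\mathcal{E})$. Let $\mathcal{K}(\mathcal{E})$ be the compact operators, generated by $\theta_{\xi,\eta}(\zeta)=\xi\langle\eta,\zeta\rangle$, and $J_{\mathcal{E}}=\varphi^{-1}(\mathcal{K}(\mathcal{E}))\cap(\ker\varphi)^\perp$, where $(\ker\varphi)^\perp=\{a: ab=0\ \forall b\in\ker\varphi\}$. A covariant representation $(\pi,\tau)$ of $\mathcal{E}$ on a $\mathrm{C}^*$-algebra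 $B$ is a $^*$-homomorphism $\pi:A\to B$ and a linear map $\tau:\mathcal{E}\to B$ with $\pi(\langle\xi,\eta\rangle)=\tau(\xi)^*\tau(\eta)$, $\pi(a)\tau(\xi)=\tau(\varphi(a)\xi)$, and $\pi(a)=\psi_\tau(\varphi(a))$ for $a\in J_{\mathcal{E}}$, where $\psi_\tau:\mathcal{K}(\mathcal{E})\to B$ is the $^*$-homomorphism with $\psi_\tau(\theta_{\xi,\eta})=\tau(\xi)\tau(\eta)^*$. The Cuntz--Pimsner algebra $\mathcal{O}(\mathcal{E})$ is the $\mathrm{C}^*$-algebra generated by the universal covariant representation of $\mathcal{E}$. *)

(* Defs.v *)
From HB Require Import structures.
From mathcomp Require Import all_boot all_order all_algebra.
From mathcomp Require Import all_classical all_reals topology normedtype realfun.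
From mathcomp Require Import complex ring.

Set Implicit Arguments.
Unset Strict Implicit.
Unset Printing Implicit Defensive.
Import Order.TTheory GRing.Theory Num.Theory numFieldNormedType.Exports.
Local Open Scope classical_set_scope.
Local Open Scope complex_scope.
Local Open Scope ring_scope.

(* C is R[i]. The library gives its topology and norm to numFieldTypes through
   the regular module R[i]^o; they are transferred to R[i] itself, so that norms
   of normed spaces over C take their (real, nonnegative) values in R[i]. *)
HB.instance Definition _ (R : realType) := NormedModule.copy R[i] R[i]^o.

Section complex_complete.
Variable R : realType.
Implicit Types (z w : R[i]) (e : R[i]).

Lemma complex_ge0E e : 0 <= e -> e = (complex.Re e)%:C.
Proof. by move=> e0; rewrite RRe_real// ger0_real. Qed.

Lemma complex_gt0E e : 0 < e -> (e = (complex.Re e)%:C) * (0 < complex.Re e).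
Proof.
move=> e0; have E := complex_ge0E (ltW e0); split=> //.
by move: e0; rewrite E ltcR.
Qed.

Lemma norm_Im_le z : `|complex.Im z|%:C <= `|z|.
Proof.
rewrite normc_def lecR -sqrtr_sqr ler_sqrt ?sqr_ge0//.
  by rewrite lerDr sqr_ge0.
by rewrite addr_ge0 ?sqr_ge0.
Qed.

Lemma Re_continuous : continuous (@complex.Re R : R[i] -> R).
Proof.
move=> z; apply/(@cvgrPdist_lt _ _ _ (nbhs z)) => e e0; near=> w.
rewrite -ltcR (le_lt_trans _ (_ : `|z - w| < e%:C))//.
  by rewrite (le_trans _ (normc_ge_Re _))// raddfB.
by near: w; apply/nbhs_ballP; exists e%:C; rewrite /= ?ltcR// -ball_normE.
Unshelve. all: by end_near. Qed.

Lemma real_complex_continuous : continuous (fun t : R => t%:C : R[i]).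
Proof.
move=> t; apply/(@cvgrPdist_lt _ _ _ (nbhs t)) => e /complex_gt0E[-> e0]; near=> u.
rewrite -raddfB normc_def/= expr0n addr0 sqrtr_sqr ltcR.
by near: u; apply/nbhs_ballP; exists (complex.Re e).
Unshelve. all: by end_near. Qed.

Lemma complex_complete (F : set_system R[i]) :
  ProperFilter F -> cauchy F -> cvg F.
Proof.
move=> FF /cauchyP Fc.
have [a Fa] : exists a : R, (@complex.Re R @ F) --> a.
  have GF := @fmap_proper_filter _ _ (@complex.Re R) F FF.
  suff /(@cauchy_cvg R _ GF)/cvg_ex[l Fl] : cauchy (@complex.Re R @ F) by exists l.
  apply/(@cauchy_exP R R _ GF) => e e0.
  have [|z Fz] := Fc e%:C; first by rewrite ltcR.
  exists (complex.Re z); rewrite /fmap/= /nbhs/=; apply: filterS Fz => w /=.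
  rewrite -!ball_normE/= -ltcR; apply: le_lt_trans.
  by rewrite (le_trans _ (normc_ge_Re _))// raddfB.
have [b Fb] : exists b : R, (@complex.Im R @ F) --> b.
  have GF := @fmap_proper_filter _ _ (@complex.Im R) F FF.
  suff /(@cauchy_cvg R _ GF)/cvg_ex[l Fl] : cauchy (@complex.Im R @ F) by exists l.
  apply/(@cauchy_exP R R _ GF) => e e0.
  have [|z Fz] := Fc e%:C; first by rewrite ltcR.
  exists (complex.Im z); rewrite /fmap/= /nbhs/=; apply: filterS Fz => w /=.
  rewrite -!ball_normE/= -ltcR; apply: le_lt_trans.
  by rewrite (le_trans _ (norm_Im_le _))// raddfB.
apply/cvg_ex; exists (a +i* b); apply/cvgrPdist_lt => e /complex_gt0E[-> e0].
move/cvgrPdist_lt: Fa => /(_ (complex.Re e / 2)) Fa.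
move/cvgrPdist_lt: Fb => /(_ (complex.Re e / 2)) Fb.
have split_sub w : a +i* b - w = (a - complex.Re w)%:C + 'i%C * (b - complex.Im w)%:C.
  by case: w => c d; simpc.
near=> w; rewrite split_sub.
rewrite (le_lt_trans (ler_normD _ _))// normrM.
rewrite [X in _ + X * _](_ : _ = 1) ?mul1r; last first.
  by rewrite normc_def/= expr0n expr1n add0r sqrtr1.
rewrite !normc_def/= expr0n !addr0 !sqrtr_sqr -raddfD ltcR [ltRHS]splitr ltrD//.
  by near: w; apply: Fa; rewrite divr_gt0.
by near: w; apply: Fb; rewrite divr_gt0.
Unshelve. all: by end_near. Qed.

End complex_complete.
HB.instance Definition _ (R : realType) :=
  Uniform_isComplete.Build R[i] (@complex_complete R).

(* C*-algebras are not required to have an identity, hence are not ringTypes. *)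
HB.mixin Record isCStarAlgebra (R : realType) A & CompleteNormedModule R[i] A := {
  cmul : A -> A -> A;
  star : A -> A;
  cmulA : associative cmul;
  cmulDl : left_distributive cmul +%R;
  cmulDr : right_distributive cmul +%R;
  cmulZl : forall (c : R[i]) a b, cmul (c *: a) b = c *: cmul a b;
  cmulZr : forall (c : R[i]) a b, cmul a (c *: b) = c *: cmul a b;
  starD : {morph star : a b / a + b};
  starZ : forall (c : R[i]) a, star (c *: a) = c^* *: star a;
  starM : forall a b, star (cmul a b) = cmul (star b) (star a);
  starK : involutive star;
  norm_cmul_le : forall a b, `|cmul a b| <= `|a| * `|b|;
  norm_cstar : forall a, `|cmul (star a) a| = `|a| ^+ 2
}.

#[short(type="cstarAlgType")]
HB.structure Definition CStarAlgebra (R : realType) :=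
  {A of CompleteNormedModule R[i] A & isCStarAlgebra R A}.

Reserved Notation "a ** b" (at level 40, left associativity).
Notation "a ** b" := (cmul a b) : ring_scope.

(* [ract xi a] is the right action and [ip] is linear in the second variable.
   In a C*-algebra the positive elements are those of the form a^* a; the norm
   of the module is |xi| = | <xi, xi> |^(1/2), for which it is complete. *)
HB.mixin Record isHilbertModule (R : realType) (A : cstarAlgType R) E
    & CompleteNormedModule R[i] E := {
  ract : E -> A -> E;
  ip : E -> E -> A;
  ractDl : forall a, {morph ract^~ a : xi eta / xi + eta};
  ractDr : forall xi, {morph ract xi : a b / a + b};
  ractZl : forall (c : R[i]) xi a, ract (c *: xi) a = c *: ract xi a;
  ractZr : forall (c : R[i]) xi a, ract xi (c *: a) = c *: ract xi a;
  ractM : forall xi a b, ract xi (a ** b) = ract (ract xi a) b;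
  ipDr : forall xi, {morph ip xi : eta zeta / eta + zeta};
  ipZr : forall (c : R[i]) xi eta, ip xi (c *: eta) = c *: ip xi eta;
  ip_ract : forall xi eta a, ip xi (ract eta a) = ip xi eta ** a;
  star_ip : forall xi eta, star (ip xi eta) = ip eta xi;
  ip_ge0 : forall xi, exists a : A, ip xi xi = star a ** a;
  ip_eq0 : forall xi, ip xi xi = 0 -> xi = 0;
  sqr_norm_ip : forall xi, `|xi| ^+ 2 = `|ip xi xi|
}.

#[short(type="hilbertModType")]
HB.structure Definition HilbertModule (R : realType) (A : cstarAlgType R) :=
  {E of CompleteNormedModule R[i] E & isHilbertModule R A E}.

Section operators.
Variables (R : realType) (A : cstarAlgType R) (E : hilbertModType A).
Implicit Types (S T : E -> E) (xi eta zeta : E).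

Definition adjoint_of T S :=
  forall xi eta, ip (T xi) eta = ip xi (S eta) :> A.

Definition adjointable T := exists S, adjoint_of T S.

Definition theta xi eta : E -> E := fun zeta => ract xi (ip eta zeta : A).

(* K(E) is the operator-norm closure, in the adjointable operators, of the span
   of the theta xi eta; scalars are absorbed since c theta xi eta is
   theta (c xi) eta. *)
Definition compact_operator T := adjointable T /\
  forall e : R, 0 < e -> exists s : seq (E * E), forall zeta,
    `|T zeta - \sum_(p <- s) theta p.1 p.2 zeta| <= e%:C * `|zeta|.

End operators.

(* [lact a] is phi(a). By [lact_star] it is adjointable, with adjoint
   phi(a^* ); being adjointable makes it C-linear and A-linear. *)
Record correspondence (R : realType) (A : cstarAlgType R) := Correspondence {
  corr_module :> hilbertModType A;
  lact : A -> corr_module -> corr_module;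
  lact_linear : forall xi, linear (lact^~ xi);
  lactM : forall a b xi, lact (a ** b) xi = lact a (lact b xi);
  lact_star : forall a, adjoint_of (lact a) (lact (star a))
}.

Definition star_hom (R : realType) (A B : cstarAlgType R) (f : A -> B) :=
  [/\ linear f, {morph f : a b / a ** b} & {morph f : a / star a}].

Section cuntz_pimsner.
Variables (R : realType) (A : cstarAlgType R) (E : correspondence A).

Definition katsura_ideal (a : A) :=
  compact_operator (@lact R A E a) /\
  forall b, (forall xi : E, lact b xi = 0) -> a ** b = 0.

Section representation.
Variables (B : cstarAlgType R) (pi : A -> B) (tau : E -> B).

(* [psi] is a *-homomorphism on K(E); its values off K(E) are irrelevant. *)
Definition compact_star_hom (psi : (E -> E) -> B) :=
  [/\ (forall (c : R[i]) (S T : E -> E),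
         compact_operator S -> compact_operator T ->
         psi (fun zeta => c *: S zeta + T zeta) = c *: psi S + psi T),
      (forall S T : E -> E, compact_operator S -> compact_operator T ->
         psi (S \o T) = psi S ** psi T) &
      (forall S T : E -> E, compact_operator S -> compact_operator T ->
         adjoint_of S T -> psi T = star (psi S))].

(* The *-homomorphism psi_tau is determined on K(E) by its values on the
   theta xi eta, so quantifying it existentially is harmless. *)
Record covariant_representation : Prop := CovariantRepresentation {
  covariant_pi : star_hom pi;
  covariant_tau : linear tau;
  covariant_ip : forall xi eta, pi (ip xi eta) = star (tau xi) ** tau eta;
  covariant_lact : forall a xi, pi a ** tau xi = tau (lact a xi);
  covariant_katsura : exists psi : (E -> E) -> B,
    [/\ compact_star_hom psi,
        (forall xi eta, psi (theta xi eta) = tau xi ** star (tau eta)) &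
        (forall a, katsura_ideal a -> pi a = psi (lact a))]
}.

End representation.

Definition closed_star_subalgebra (B : cstarAlgType R) (S : set B) :=
  [/\ closed S, S 0,
      (forall (c : R[i]) a b, S a -> S b -> S (c *: a + b)),
      (forall a b, S a -> S b -> S (a ** b)) &
      (forall a, S a -> S (star a))].

Definition generates (B : cstarAlgType R) (G : set B) :=
  forall S, closed_star_subalgebra S -> G `<=` S -> S = [set: B].

(* O, together with (pi, tau), is the Cuntz-Pimsner algebra of E: a C*-algebra
   generated by a covariant representation through which every other one
   factors. These properties determine (O, pi, tau) up to isomorphism; the
   factorization is unique because O is generated by the images. *)
Record cuntz_pimsner (O : cstarAlgType R) (pi : A -> O) (tau : E -> O) : Prop :=
  CuntzPimsner {
  cp_covariant : covariant_representation pi tau;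
  cp_generates : generates (range pi `|` range tau);
  cp_universal : forall (B : cstarAlgType R) (pi' : A -> B) (tau' : E -> B),
    covariant_representation pi' tau' ->
    exists rho : O -> B,
      [/\ star_hom rho, rho \o pi = pi' & rho \o tau = tau']
}.

End cuntz_pimsner.

Section stable_finiteness.
Variables (R : realType) (A : cstarAlgType R).

Definition is_identity (e : A) := forall a : A, e ** a = a /\ a ** e = a.

Definition mxcmul n (u v : 'M[A]_n) : 'M[A]_n :=
  \matrix_(i, j) \sum_k u i k ** v k j.

Definition mxstar n (u : 'M[A]_n) : 'M[A]_n := \matrix_(i, j) star (u j i).

Definition mxidentity n (e : A) : 'M[A]_n := \matrix_(i, j) (e *+ (i == j)).

(* Stable finiteness of a unital C*-algebra: every isometry of every M_n(A) is
   unitary, i.e. the identity of M_n(A) is a finite projection. *)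
Definition stably_finite := exists2 e : A, is_identity e &
  forall n (v : 'M[A]_n),
    mxcmul (mxstar v) v = mxidentity n e -> mxcmul v (mxstar v) = mxidentity n e.

End stable_finiteness.

Record homeomorphism (X : topologicalType) := Homeomorphism {
  homeo_fun :> X -> X;
  homeo_inv : X -> X;
  homeo_continuous : continuous homeo_fun;
  homeo_inv_continuous : continuous homeo_inv;
  homeo_funK : cancel homeo_fun homeo_inv;
  homeo_invK : cancel homeo_inv homeo_fun
}.

Definition minimal_map (X : topologicalType) (alpha : X -> X) :=
  forall E : set X, closed E -> alpha @` E `<=` E -> E = set0 \/ E = setT.

(* [fibre V x] is the fibre over x as a complex vector space, identified with
   the subset p^-1(x) of the total space by [fibre_incl]. A local
   trivialization over U is the homeomorphism v |-> (p v, g v) from p^-1(U) onto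
   U x C, with inverse h, linear on fibres; the fibres are thus
   one-dimensional. [herm v w] is meaningful only for v and w in the same fibre,
   and it is continuous on the fibre product of the total space with itself. *)
Record lineBundle (R : realType) (X : topologicalType) := LineBundle {
  total_space : topologicalType;
  bundle_proj : total_space -> X;
  fibre : X -> lmodType R[i];
  fibre_incl : forall x, fibre x -> total_space;
  bundle_proj_continuous : continuous bundle_proj;
  fibre_incl_inj : forall x, injective (@fibre_incl x);
  range_fibre_incl : forall x, range (@fibre_incl x) = bundle_proj @^-1` [set x];
  locally_trivial : forall x, exists U : set X,
    [/\ open U, U x &
      exists g : total_space -> R[i], exists h : X * R[i] -> total_space,
      [/\ {within bundle_proj @^-1` U, continuous g},
          {within U `*` [set: R[i]], continuous h},
          (forall v, U (bundle_proj v) -> h (bundle_proj v, g v) = v),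
          (forall y c, U y -> bundle_proj (h (y, c)) = y /\ g (h (y, c)) = c) &
          (forall y (c : R[i]) (v w : fibre y), U y ->
             g (fibre_incl (c *: v + w)) = c * g (fibre_incl v) + g (fibre_incl w))]];
  herm : total_space -> total_space -> R[i];
  herm_continuous : {within [set vw : total_space * total_space | bundle_proj vw.1 = bundle_proj vw.2],
    continuous (fun vw : total_space * total_space => herm vw.1 vw.2)};
  herm_linear : forall x (c : R[i]) (u v w : fibre x),
    herm (fibre_incl u) (fibre_incl (c *: v + w)) =
    c * herm (fibre_incl u) (fibre_incl v) + herm (fibre_incl u) (fibre_incl w);
  herm_sym : forall x (v w : fibre x),
    herm (fibre_incl w) (fibre_incl v) = (herm (fibre_incl v) (fibre_incl w))^*;
  herm_ge0 : forall x (v : fibre x), 0 <= herm (fibre_incl v) (fibre_incl v);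
  herm_eq0 : forall x (v : fibre x), herm (fibre_incl v) (fibre_incl v) = 0 -> v = 0
}.

Section sup_norm.
Variables (R : realType) (X : topologicalType) (cptX : compact [set: X]).

(* sup set0 = 0, so this is also correct on the empty space. *)
Definition sup_norm (g : X -> R[i]) : R[i] :=
  (sup (range (fun x => complex.Re `|g x|)))%:C.

Lemma Re_norm (z : R[i]) : (complex.Re `|z|)%:C = `|z|.
Proof. by rewrite -complex_ge0E. Qed.

Lemma sup_norm_le (g : X -> R[i]) M :
  0 <= M -> (forall x, `|g x| <= M) -> sup_norm g <= M.
Proof.
move=> M0 gM; rewrite /sup_norm (complex_ge0E M0) lecR.
have [[x _]|X0] := pselect (exists x : X, True); last first.
  suff -> : range (fun x => complex.Re `|g x|) = set0.
    by rewrite sup0 -lecR -complex_ge0E.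
  by rewrite -subset0 => y [x _ _]; apply: X0; exists x.
apply: ge_sup; first by exists (complex.Re `|g x|); exists x.
by move=> _ [y _ <-]; rewrite -lecR Re_norm -complex_ge0E.
Qed.

Lemma sup_norm_ub (g : X -> R[i]) x : continuous g -> `|g x| <= sup_norm g.
Proof.
move=> gc; rewrite /sup_norm -Re_norm lecR; apply: ub_le_sup; last by exists x.
have gc' : continuous (fun y => complex.Re `|g y|).
  move=> y; apply: (@continuous_comp _ _ _ (fun y => `|g y|) (@complex.Re R)).
    apply: (@continuous_comp _ _ _ g (@Num.norm _ R[i])); first exact: gc.
    exact: (@norm_continuous R[i] R[i]).
  exact: Re_continuous.
have [] := @compact_bounded R R _ (continuous_compact (continuous_subspaceT gc') cptX).
move=> M [_ Mb]; exists (M + 1) => _ [y _ <-].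
apply: le_trans (ler_norm _) _; apply: (Mb (M + 1)); last by exists y.
by rewrite ltrDl.
Qed.

Lemma sup_norm_ge0 (g : X -> R[i]) : 0 <= sup_norm g.
Proof.
rewrite /sup_norm lecR.
have [[x _]|X0] := pselect (exists x : X, True); last first.
  suff -> : range (fun x => complex.Re `|g x|) = set0 by rewrite sup0 lexx.
  by rewrite -subset0 => y [x _ _]; apply: X0; exists x.
have [hs|hs] := pselect (has_sup (range (fun x => complex.Re `|g x|))); last first.
  by rewrite sup_out.
apply: (@le_trans _ R (complex.Re `|g x|)).
  by rewrite -lecR Re_norm; exact: normr_ge0.
by apply: (sup_upper_bound hs); exists x.
Qed.

End sup_norm.

Section sup_norm_complete.
Variables (R : realType) (X : Type) (E : normedModType R[i]).
Variable ev : X -> E -> R[i].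
Hypothesis evB : forall x s t, ev x (s - t) = ev x s - ev x t.
Hypothesis ev_le : forall x s, `|ev x s| <= `|s|.
Hypothesis norm_le : forall s M, 0 <= M -> (forall x, `|ev x s| <= M) -> `|s| <= M.
Hypothesis ev_lim : forall l : X -> R[i],
  (forall e, 0 < e -> exists s, forall x, `|ev x s - l x| <= e) ->
  exists s, forall x, ev x s = l x.

Lemma sup_norm_complete (F : set_system E) : ProperFilter F -> cauchy F -> cvg F.
Proof.
move=> FF /cauchyP Fc.
have cvgx x : exists l : R[i], (ev x @ F) --> l.
  have GF := @fmap_proper_filter _ _ (ev x) F FF.
  suff /(@cauchy_cvg R[i] _ GF)/cvg_ex[l Fl] : cauchy (ev x @ F) by exists l.
  apply/(@cauchy_exP R[i] R[i] _ GF) => e e0.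
  have [//|s Fs] := Fc e.
  exists (ev x s); rewrite /fmap/= /nbhs/=; apply: filterS Fs => t /=.
  by rewrite -!ball_normE/= -evB; apply: le_lt_trans.
have [l Fl] := choice cvgx.
have unif e : 0 < e -> exists s, F (ball s e) /\
    forall t, ball s e t -> forall x, `|ev x t - l x| <= e *+ 3.
  move=> e0; have [//|s Fs] := Fc e; exists s; split=> // t st x.
  have Fd := (@cvgrPdist_lt _ _ _ F FF _ _).1 (Fl x) e e0.
  have [u [/= ud su]] := filter_ex (filterI Fd Fs).
  move: st su; rewrite -!ball_normE/= => st su.
  have -> : ev x t - l x = - (ev x s - ev x t) + (ev x s - ev x u) - (l x - ev x u).
    by ring.
  rewrite (le_trans (ler_normB _ _))// mulrSr lerD ?(ltW ud)//.
  rewrite (le_trans (ler_normD _ _))// normrN mulr2n lerD// -evB.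
    exact: le_trans (ev_le _ _) (ltW st).
  exact: le_trans (ev_le _ _) (ltW su).
have div3 (e : R[i]) : 0 < e -> 0 < e / 3 /\ (e / 3) *+ 3 = e.
  move=> e0; rewrite divr_gt0 ?ltr0n//; split=> //.
  by rewrite -[LHS]mulr_natr mulfVK// pnatr_eq0.
have [e e0|s0 s0E] := @ev_lim l.
  have [e30 e3] := div3 e e0; have [s [Fs Hs]] := unif _ e30.
  exists s => x; rewrite -[leRHS]e3; apply: Hs; exact: ballxx.
apply/cvg_ex; exists s0; apply/(@cvgrPdist_le _ _ _ F FF) => e e0.
have [e30 e3] := div3 e e0; have [s [Fs Hs]] := unif _ e30.
apply: filterS Fs => t st; apply: norm_le; first exact: ltW.
by move=> x; rewrite evB s0E distrC -[leRHS]e3; apply: Hs.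
Qed.

End sup_norm_complete.

(* C(X), with pointwise operations and the supremum norm. The compactness proof
   is an argument of the type because the norm is finite only for compact X. *)
Definition contC (R : realType) (X : topologicalType) (cptX : compact [set: X]) :=
  continuousType X R[i].

Section contC_instances.
Variables (R : realType) (X : topologicalType) (cptX : compact [set: X]).
Notation CX := (contC R cptX).
Implicit Types (f g : CX) (c : R[i]).

HB.instance Definition _ := Choice.copy CX (continuousType X R[i]).

Lemma contC_eqP f g : f =1 g -> f = g.
Proof. by move/continuousEP. Qed.

Definition mkC (f : X -> R[i]) (fc : continuous f) : CX := mkcts fc.

Lemma contC_cts f : continuous f. Proof. exact: cts_fun. Qed.

Lemma addC_cts f g : continuous (fun x => f x + g x).
Proof. by move=> x; exact: cvgD (@contC_cts f x) (@contC_cts g x). Qed.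

Lemma oppC_cts f : continuous (fun x => - f x).
Proof. by move=> x; exact: cvgN (@contC_cts f x). Qed.

Lemma cstC_cts c : continuous (fun _ : X => c).
Proof. by move=> x; apply: cvg_cst. Qed.

Lemma mulC_cts f g : continuous (fun x => f x * g x).
Proof. by move=> x; exact: (@cvgM R[i]) (@contC_cts f x) (@contC_cts g x). Qed.

Lemma conj_continuous : continuous (fun z : R[i] => z^*).
Proof.
move=> z; apply/(@cvgrPdist_lt _ _ _ (nbhs z)) => e e0; near=> w.
rewrite -rmorphB norm_conjC.
by near: w; apply/nbhs_ballP; exists e => //; rewrite -ball_normE.
Unshelve. all: by end_near. Qed.

Lemma conjC_cts f : continuous (fun x => (f x)^*).
Proof.
move=> x; apply: (@continuous_comp _ _ _ f (fun z : R[i] => z^*)).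
  exact: contC_cts.
exact: conj_continuous.
Qed.

Let addfA : associative (fun f g => mkC (@addC_cts f g)).
Proof. by move=> f g h; apply: contC_eqP => x; exact: addrA. Qed.
Let addfC : commutative (fun f g => mkC (@addC_cts f g)).
Proof. by move=> f g; apply: contC_eqP => x; exact: addrC. Qed.
Let add0f : left_id (mkC (@cstC_cts 0)) (fun f g => mkC (@addC_cts f g)).
Proof. by move=> f; apply: contC_eqP => x; exact: add0r. Qed.
Let addNf : left_inverse (mkC (@cstC_cts 0)) (fun f => mkC (@oppC_cts f))
  (fun f g => mkC (@addC_cts f g)).
Proof. by move=> f; apply: contC_eqP => x; exact: addNr. Qed.

HB.instance Definition _ := GRing.isZmodule.Build CX addfA addfC add0f addNf.

Let scalef c f : CX := mkC (@mulC_cts (mkC (@cstC_cts c)) f).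
Let scalefA c d f : scalef c (scalef d f) = scalef (c * d) f.
Proof. by apply: contC_eqP => x; exact: mulrA. Qed.
Let scale1f : left_id 1 scalef.
Proof. by move=> f; apply: contC_eqP => x; exact: mul1r. Qed.
Let scalefDr : right_distributive scalef +%R.
Proof. by move=> c f g; apply: contC_eqP => x; exact: mulrDr. Qed.
Let scalefDl f : {morph scalef^~ f : c d / c + d}.
Proof. by move=> c d; apply: contC_eqP => x; exact: mulrDl. Qed.

HB.instance Definition _ := GRing.Zmodule_isLmodule.Build R[i] CX
  scalefA scale1f scalefDr scalefDl.

Lemma contCDE f g x : (f + g) x = f x + g x. Proof. by []. Qed.
Lemma contCNE f x : (- f) x = - f x. Proof. by []. Qed.
Lemma contCBE f g x : (f - g) x = f x - g x. Proof. by []. Qed.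
Lemma contCZE c f x : (c *: f) x = c * f x. Proof. by []. Qed.
Lemma contC0E x : (0 : CX) x = 0. Proof. by []. Qed.

Let fub f x : `|f x| <= sup_norm f.
Proof. by apply: sup_norm_ub => //; exact: contC_cts. Qed.

Let normD f g : sup_norm (f + g) <= sup_norm f + sup_norm g.
Proof.
apply: sup_norm_le; first by rewrite addr_ge0 ?sup_norm_ge0.
by move=> x; rewrite contCDE (le_trans (ler_normD _ _))// lerD.
Qed.
Let normZ c f : sup_norm (c *: f) = `|c| * sup_norm f.
Proof.
have le_scale d (h : CX) : sup_norm (d *: h) <= `|d| * sup_norm h.
  apply: sup_norm_le; first by rewrite mulr_ge0 ?sup_norm_ge0.
  by move=> x; rewrite contCZE normrM ler_wpM2l.
have [->|c0] := eqVneq c 0.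
  apply/eqP; rewrite eq_le le_scale normr0 mul0r; exact: sup_norm_ge0.
apply/eqP; rewrite eq_le le_scale/= -ler_pdivlMl ?normr_gt0// -normfV.
by rewrite -{1}[f]scale1r -(mulVf c0) -scalerA; exact: le_scale.
Qed.
Let norm0 f : sup_norm f = 0 -> f = 0.
Proof.
move=> f0; apply: contC_eqP => x; apply/eqP; rewrite -normr_le0 -f0; exact: fub.
Qed.

HB.instance Definition _ := Lmodule_isNormed.Build R[i] CX normD normZ norm0.

Lemma contC_normE f : `|f| = sup_norm f. Proof. by []. Qed.

Lemma contC_norm_ub f x : `|f x| <= `|f|. Proof. exact: fub. Qed.

Lemma contC_norm_le f M : 0 <= M -> (forall x, `|f x| <= M) -> `|f| <= M.
Proof. exact: sup_norm_le. Qed.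

Lemma uniform_limit_cts (l : X -> R[i]) :
  (forall e, 0 < e -> exists f, forall x, `|f x - l x| <= e) -> continuous l.
Proof.
move=> fl x; apply/(@cvgrPdist_le _ _ _ (nbhs x)) => e e0.
have [|f fP] := fl (e / 3); first by rewrite divr_gt0 ?ltr0n.
have := @contC_cts f x => /(@cvgrPdist_le _ _ _ (nbhs x)) /(_ (e / 3)).
rewrite divr_gt0 ?ltr0n// => /(_ isT); apply: filterS => y fxy.
have -> : l x - l y = - (f x - l x) + (f x - f y) + (f y - l y) by ring.
have -> : e = e / 3 + e / 3 + e / 3 by field.
by rewrite !(le_trans (ler_normD _ _))// ?lerD ?normrN// (le_trans (ler_normD _ _))// lerD ?normrN.
Qed.

Let contC_complete (F : set_system CX) : ProperFilter F -> cauchy F -> cvg F.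
Proof.
apply: (@sup_norm_complete R X CX (fun x f => f x)) => //.
- by move=> f M; exact: contC_norm_le.
- by move=> l /uniform_limit_cts lc; exists (mkC lc).
Qed.

HB.instance Definition _ := Uniform_isComplete.Build CX contC_complete.

Let mulf f g : CX := mkC (@mulC_cts f g).
Let starf f : CX := mkC (@conjC_cts f).
Let mulfA : associative mulf.
Proof. by move=> f g h; apply: contC_eqP => x; exact: mulrA. Qed.
Let mulfDl : left_distributive mulf +%R.
Proof. by move=> f g h; apply: contC_eqP => x; exact: mulrDl. Qed.
Let mulfDr : right_distributive mulf +%R.
Proof. by move=> f g h; apply: contC_eqP => x; exact: mulrDr. Qed.
Let mulfZl c f g : mulf (c *: f) g = c *: mulf f g.
Proof. by apply: contC_eqP => x; exact: esym (mulrA _ _ _). Qed.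
Let mulfZr c f g : mulf f (c *: g) = c *: mulf f g.
Proof. by apply: contC_eqP => x; exact: mulrCA. Qed.
Let starfD : {morph starf : f g / f + g}.
Proof. by move=> f g; apply: contC_eqP => x; exact: rmorphD. Qed.
Let starfZ c f : starf (c *: f) = c^* *: starf f.
Proof. by apply: contC_eqP => x; exact: rmorphM. Qed.
Let starfM f g : starf (mulf f g) = mulf (starf g) (starf f).
Proof. by apply: contC_eqP => x; exact: etrans (rmorphM _ _ _) (mulrC _ _). Qed.
Let starfK : involutive starf.
Proof. by move=> f; apply: contC_eqP => x; exact: conjCK. Qed.
Let norm_mulf f g : `|mulf f g| <= `|f| * `|g|.
Proof.
apply: contC_norm_le; first by rewrite mulr_ge0.
by move=> x; rewrite normrM ler_pM// contC_norm_ub.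
Qed.
Let norm_starf f : `|mulf (starf f) f| = `|f| ^+ 2.
Proof.
have sqE x : `|f x| ^+ 2 = mulf (starf f) f x by rewrite normCK mulrC.
apply/eqP; rewrite eq_le; apply/andP; split.
  apply: contC_norm_le; first by rewrite exprn_ge0.
  by move=> x; rewrite -sqE normrX normr_id ler_pXn2r ?nnegrE// contC_norm_ub.
rewrite -[leRHS]sqrtCK ler_pXn2r ?nnegrE ?sqrtC_ge0//.
apply: contC_norm_le; first by rewrite sqrtC_ge0.
move=> x; rewrite -(@ler_pXn2r _ 2) ?nnegrE ?sqrtC_ge0// sqrtCK sqE.
by rewrite -[leLHS]ger0_norm ?contC_norm_ub// -sqE exprn_ge0.
Qed.

HB.instance Definition _ := isCStarAlgebra.Build R CX
  mulfA mulfDl mulfDr mulfZl mulfZr starfD starfZ starfM starfK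
  norm_mulf norm_starf.

End contC_instances.

(* A continuous section: x |-> xi(x) in p^-1(x), continuous into the total
   space. *)
Record csection (R : realType) (X : topologicalType) (V : lineBundle R X) :=
  CSection {
  sec_fun :> forall x, fibre V x;
  sec_continuous : continuous (fun x => fibre_incl (sec_fun x))
}.

Section bundle_lemmas.
Variables (R : realType) (X : topologicalType) (V : lineBundle R X).
Implicit Types (xi eta : csection V) (x y : X) (c : R[i]).

Lemma within_comp_continuous (S T U : topologicalType) (A : set T) (F : T -> U)
    (phi : S -> T) (s : S) :
  {within A, continuous F} -> (\forall r \near s, A (phi r)) ->
  {for s, continuous phi} -> {for s, continuous (F \o phi)}.
Proof.
move=> FA phiA phis W FW.
have As : A (phi s) by exact: nbhs_singleton phiA.
have AW : within A (nbhs (phi s)) (F @^-1` W).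
  by rewrite (nbhs_subspace_in As); exact: (FA (phi s) W FW).
have := phis _ AW; rewrite /nbhs/= => phiAW.
by apply: filterS2 phiA phiAW => r /= Ar; apply.
Qed.

Lemma bundle_proj_fibre_incl x (v : fibre V x) : bundle_proj (fibre_incl v) = x.
Proof. by have : range (@fibre_incl _ _ V x) (fibre_incl v) by []; rewrite range_fibre_incl. Qed.

Lemma in_fibre x (v : total_space V) : bundle_proj v = x -> exists w : fibre V x, fibre_incl w = v.
Proof.
move=> vx; have : (bundle_proj (l:=V) @^-1` [set x]) v by [].
by rewrite -range_fibre_incl => -[w _ <-]; exists w.
Qed.

Section chart.
Variables (U : set X) (g : total_space V -> R[i]) (h : X * R[i] -> total_space V).
Hypotheses (oU : open U)
  (gc : {within bundle_proj (l:=V) @^-1` U, continuous g})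
  (hc : {within U `*` [set: R[i]], continuous h})
  (gK : forall v, U (bundle_proj v) -> h (bundle_proj v, g v) = v)
  (hK : forall y c, U y -> bundle_proj (h (y, c)) = y /\ g (h (y, c)) = c)
  (glin : forall y c (v w : fibre V y), U y ->
     g (fibre_incl (c *: v + w)) = c * g (fibre_incl v) + g (fibre_incl w)).

Lemma chart_inj y (v w : fibre V y) : U y -> g (fibre_incl v) = g (fibre_incl w) -> v = w.
Proof.
move=> Uy vw; apply: fibre_incl_inj.
by rewrite -(gK (v := fibre_incl v)) ?bundle_proj_fibre_incl// vw -(gK (v := fibre_incl w)) ?bundle_proj_fibre_incl// (hK _ Uy).2.
Qed.

Lemma chart0 y : U y -> g (fibre_incl (0 : fibre V y)) = 0.
Proof.
move=> Uy; have := glin 1 0 (0 : fibre V y) Uy.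
by rewrite scaler0 addr0 mul1r => /eqP; rewrite -subr_eq subrr eq_sym => /eqP.
Qed.

Lemma chartZ y c (v : fibre V y) : U y -> g (fibre_incl (c *: v)) = c * g (fibre_incl v).
Proof. by move=> Uy; rewrite -[c *: v]addr0 glin// chart0// addr0. Qed.

Lemma chart_frame y : U y -> exists e : fibre V y, fibre_incl e = h (y, 1) /\
  forall v, v = g (fibre_incl v) *: e.
Proof.
move=> Uy; have [e eE] := in_fibre (hK 1 Uy).1; exists e; split=> // v.
by apply: chart_inj => //; rewrite chartZ// eE (hK 1 Uy).2 mulr1.
Qed.

Lemma chart_continuousP (s : forall x, fibre V x) x : U x ->
  {for x, continuous (fun y => g (fibre_incl (s y)))} <->
  {for x, continuous (fun y => fibre_incl (s y))}.
Proof.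
move=> Ux; have nU : \forall y \near x, U y by exact: open_nbhs_nbhs.
split=> sc; last first.
  apply: (within_comp_continuous gc _ sc).
  by apply: filterS nU => y Uy /=; rewrite bundle_proj_fibre_incl.
have : {for x, continuous (fun y => h (y, g (fibre_incl (s y))))}.
  apply: (within_comp_continuous hc (phi := fun y => (y, g (fibre_incl (s y))))).
    by apply: filterS nU => y.
  exact: (cvg_pair (@cvg_id _ (nbhs x)) sc).
have sE y : U y -> h (y, g (fibre_incl (s y))) = fibre_incl (s y).
  by have := gK (v := fibre_incl (s y)); rewrite bundle_proj_fibre_incl.
move=> hcx; have {}hcx : h (y, g (fibre_incl (s y))) @[y --> nbhs x] --> fibre_incl (s x).
  by rewrite -(sE x Ux); exact: hcx.
apply: cvg_trans hcx; apply: near_eq_cvg.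
by apply: filterS nU => y Uy; exact: sE.
Qed.

End chart.

Lemma section_continuousP (s : forall x, fibre V x) :
  (forall x (g : total_space V -> R[i]), (forall xi, {for x, continuous (fun y => g (fibre_incl (xi y)))}) ->
    (\forall y \near x, forall c (v w : fibre V y),
     g (fibre_incl (c *: v + w)) = c * g (fibre_incl v) + g (fibre_incl w)) ->
     {for x, continuous (fun y => g (fibre_incl (s y)))}) ->
  continuous (fun x => fibre_incl (s x)).
Proof.
move=> sP x; have [U [oU Ux [g [h [gc hc gK hK glin]]]]] := locally_trivial V x.
apply/(chart_continuousP oU gc hc gK _ Ux)/sP => [xi|].
  by apply/(chart_continuousP oU gc hc gK _ Ux); exact: sec_continuous.
have nU : \forall y \near x, U y by exact: open_nbhs_nbhs.
by apply: filterS nU => y Uy c v w; exact: glin.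
Qed.

End bundle_lemmas.

(* Gamma(V), as a right Hilbert C(X)-module: (xi f)(x) = f(x) xi(x) and
   <xi, eta>(x) = <xi(x), eta(x)>. *)
Definition sections (R : realType) (X : topologicalType)
  (cptX : compact [set: X]) (V : lineBundle R X) := csection V.

Section sections_instances.
Variables (R : realType) (X : topologicalType) (cptX : compact [set: X]).
Variable V : lineBundle R X.
Notation CX := (contC R cptX).
Notation Gam := (sections cptX V).
Implicit Types (xi eta zeta : Gam) (f : CX) (x y : X) (c : R[i]).

HB.instance Definition _ := gen_eqMixin Gam.
HB.instance Definition _ := gen_choiceMixin Gam.

Lemma sectionP xi eta : (forall x, xi x = eta x) -> xi = eta.
Proof.
case: xi eta => s sc [t tc] /= st; have E : s = t by exact: functional_extensionality_dep.
by case: t / E tc {st} => tc; congr CSection; exact: Prop_irrelevance.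
Qed.

Lemma near_addg (g : total_space V -> R[i]) x :
  (\forall y \near x, forall c (v w : fibre V y),
     g (fibre_incl (c *: v + w)) = c * g (fibre_incl v) + g (fibre_incl w)) ->
  \forall y \near x, [/\ g (fibre_incl (0 : fibre V y)) = 0,
    (forall v w : fibre V y, g (fibre_incl (v + w)) = g (fibre_incl v) + g (fibre_incl w)) &
    (forall c (v : fibre V y), g (fibre_incl (c *: v)) = c * g (fibre_incl v))].
Proof.
apply: filterS => y gl.
have g0 : g (fibre_incl (0 : fibre V y)) = 0.
  have := gl 1 0 0.
  by rewrite scaler0 addr0 mul1r => /eqP; rewrite -subr_eq subrr eq_sym => /eqP.
split=> // [v w|c v]; first by have := gl 1 v w; rewrite scale1r mul1r.
by have := gl c v 0; rewrite addr0 g0 addr0.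
Qed.

Lemma zero_sec : continuous (fun x => fibre_incl (0 : fibre V x)).
Proof.
apply: (section_continuousP (s := fun x => 0)) => x g gc /near_addg gl.
apply: (@cvg_trans _ ((fun=> 0 : R[i]) @ nbhs x)).
  by apply: near_eq_cvg; apply: filterS gl => y [g0 _ _]; rewrite g0.
have [-> _ _] := nbhs_singleton gl; exact: cvg_cst.
Qed.

Lemma add_sec xi eta : continuous (fun x => fibre_incl (xi x + eta x)).
Proof.
apply: (section_continuousP (s := fun x => xi x + eta x)) => x g gc /near_addg gl.
apply: (@cvg_trans _ ((fun y => g (fibre_incl (xi y)) + g (fibre_incl (eta y))) @ nbhs x)).
  by apply: near_eq_cvg; apply: filterS gl => y [_ gD _]; rewrite gD.
by have [_ -> _] := nbhs_singleton gl; exact: cvgD (gc xi) (gc eta).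
Qed.

Lemma mul_sec xi f : continuous (fun x => fibre_incl (f x *: xi x)).
Proof.
apply: (section_continuousP (s := fun x => f x *: xi x)) => x g gc /near_addg gl.
apply: (@cvg_trans _ ((fun y => f y * g (fibre_incl (xi y))) @ nbhs x)).
  by apply: near_eq_cvg; apply: filterS gl => y [_ _ gZ]; rewrite gZ.
have [_ _ ->] := nbhs_singleton gl.
exact: (@cvgM R[i]) (@contC_cts _ _ _ f x) (gc xi).
Qed.

Let zeros : Gam := CSection zero_sec.
Let adds xi eta : Gam := CSection (@add_sec xi eta).
Let muls xi f : Gam := CSection (@mul_sec xi f).
Let cstC c : CX := mkC cptX (@cstC_cts R X c).
Let opps xi : Gam := muls xi (cstC (-1)).

Let addsA : associative adds.
Proof. by move=> ? ? ?; apply: sectionP => x; exact: addrA. Qed.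
Let addsC : commutative adds.
Proof. by move=> ? ?; apply: sectionP => x; exact: addrC. Qed.
Let add0s : left_id zeros adds.
Proof. by move=> ?; apply: sectionP => x; exact: add0r. Qed.
Let addNs : left_inverse zeros opps adds.
Proof.
move=> xi; apply: sectionP => x /=.
by rewrite [cstC _ _](_ : _ = -1)// scaleN1r addNr.
Qed.

HB.instance Definition _ := GRing.isZmodule.Build Gam addsA addsC add0s addNs.

Let scales c xi : Gam := muls xi (cstC c).
Let scalesA c d xi : scales c (scales d xi) = scales (c * d) xi.
Proof. by apply: sectionP => x; exact: scalerA. Qed.
Let scale1s : left_id 1 scales.
Proof. by move=> xi; apply: sectionP => x; exact: scale1r. Qed.
Let scalesDr : right_distributive scales +%R.
Proof. by move=> c xi eta; apply: sectionP => x; exact: scalerDr. Qed.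
Let scalesDl xi : {morph scales^~ xi : c d / c + d}.
Proof. by move=> c d; apply: sectionP => x; exact: scalerDl. Qed.

HB.instance Definition _ := GRing.Zmodule_isLmodule.Build R[i] Gam
  scalesA scale1s scalesDr scalesDl.

Lemma secDE xi eta x : (xi + eta) x = xi x + eta x. Proof. by []. Qed.
Lemma secZE c xi x : (c *: xi) x = c *: xi x. Proof. by []. Qed.
Lemma sec0E x : (0 : Gam) x = 0. Proof. by []. Qed.
Lemma secBE xi eta x : (xi - eta) x = xi x - eta x.
Proof. by rewrite secDE -[- eta]scaleN1r secZE scaleN1r. Qed.

Definition hm x (v w : fibre V x) : R[i] := herm (fibre_incl v) (fibre_incl w).

Lemma hm_sym x (v w : fibre V x) : hm w v = (hm v w)^*.
Proof. exact: herm_sym. Qed.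
Lemma hm_lin x c (u v w : fibre V x) : hm u (c *: v + w) = c * hm u v + hm u w.
Proof. exact: herm_linear. Qed.
Lemma hm0r x (u : fibre V x) : hm u 0 = 0.
Proof.
have := hm_lin 1 u 0 0.
by rewrite scaler0 addr0 mul1r => /eqP; rewrite -subr_eq subrr eq_sym => /eqP.
Qed.
Lemma hmZr x c (u v : fibre V x) : hm u (c *: v) = c * hm u v.
Proof. by have := hm_lin c u v 0; rewrite hm0r !addr0. Qed.
Lemma hmDr x (u v w : fibre V x) : hm u (v + w) = hm u v + hm u w.
Proof. by have := hm_lin 1 u v w; rewrite scale1r mul1r. Qed.
Lemma hmBr x (u v w : fibre V x) : hm u (v - w) = hm u v - hm u w.
Proof. by rewrite hmDr -scaleN1r hmZr mulN1r. Qed.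
Lemma hmZl x c (u v : fibre V x) : hm (c *: u) v = c^* * hm u v.
Proof. by rewrite hm_sym hmZr rmorphM/= -hm_sym. Qed.

Lemma ip_sec xi eta : continuous (fun x => herm (fibre_incl (xi x)) (fibre_incl (eta x))).
Proof.
move=> x; apply: (within_comp_continuous (@herm_continuous _ _ V)
  (phi := fun x => (fibre_incl (xi x), fibre_incl (eta x)))).
  by apply: nearW => y; rewrite /= !bundle_proj_fibre_incl.
exact: (cvg_pair (@sec_continuous _ _ _ xi x) (@sec_continuous _ _ _ eta x)).
Qed.

Let ips xi eta : CX := mkC cptX (@ip_sec xi eta).

Lemma exists_unit_vector x : exists u : fibre V x,
  hm u u = 1 /\ forall v, v = hm u v *: u.
Proof.
have [U [oU Ux [g [h [gc hc gK hK glin]]]]] := locally_trivial V x.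
have [e [eE eP]] := chart_frame gK hK glin Ux.
have e0 : hm e e != 0.
  apply/eqP => /herm_eq0 e0; have := (hK x 1 Ux).2.
  rewrite -eE e0 (chart0 glin Ux) => /esym/eqP; exact/negP/oner_neq0.
have q0 : 0 < hm e e by rewrite lt_def e0 herm_ge0.
set q := sqrtC (hm e e).
have qp : 0 < q by rewrite sqrtC_gt0.
have qr : (q^-1)^* = q^-1 by rewrite conj_Creal// realE invr_ge0 (ltW qp).
exists (q^-1 *: e); split.
  by rewrite hmZr hmZl qr mulrA -invfM -expr2 sqrtCK mulVf.
move=> v; have [k ->] : exists k, v = k *: e by exists (g (fibre_incl v)).
rewrite hmZl hmZr qr scalerA; congr (_ *: _).
have -> : hm e e = q ^+ 2 by rewrite sqrtCK.
by field; rewrite gt_eqF.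
Qed.

Definition uvec x : fibre V x := sval (cid (exists_unit_vector x)).
Lemma uvec1 x : hm (uvec x) (uvec x) = 1.
Proof. by rewrite /uvec; case: cid => u []. Qed.
Lemma uvecE x (v : fibre V x) : v = hm (uvec x) v *: uvec x.
Proof. by rewrite /uvec; case: cid => u []. Qed.

Definition ev x xi : R[i] := hm (uvec x) (xi x).

Lemma hm_uvec x (v w : fibre V x) :
  hm v w = (hm (uvec x) v)^* * hm (uvec x) w.
Proof. by rewrite {1}[v]uvecE {1}[w]uvecE hmZl hmZr uvec1 mulr1. Qed.

Lemma sqr_ev x xi : ips xi xi x = `|ev x xi| ^+ 2.
Proof. by rewrite normCKC -hm_uvec. Qed.

Definition norm_sec xi : R[i] := sqrtC `|ips xi xi|.

Let norm_sec_ge0 xi : 0 <= norm_sec xi.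
Proof. by rewrite sqrtC_ge0. Qed.

Let ev_ub x xi : `|ev x xi| <= norm_sec xi.
Proof.
rewrite -(@ler_pXn2r _ 2) ?nnegrE// sqrtCK -sqr_ev.
rewrite -[leLHS]ger0_norm; last by rewrite sqr_ev exprn_ge0.
exact: contC_norm_ub.
Qed.

Let norm_sec_le xi M : 0 <= M -> (forall x, `|ev x xi| <= M) -> norm_sec xi <= M.
Proof.
move=> M0 evM; rewrite -(@ler_pXn2r _ 2) ?nnegrE// sqrtCK.
apply: contC_norm_le; first by rewrite exprn_ge0.
by move=> x; rewrite sqr_ev normrX normr_id ler_pXn2r ?nnegrE.
Qed.

Let normD xi eta : norm_sec (xi + eta) <= norm_sec xi + norm_sec eta.
Proof.
apply: norm_sec_le; first by rewrite addr_ge0.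
by move=> x; rewrite /ev secDE hmDr (le_trans (ler_normD _ _))// lerD// ev_ub.
Qed.

Let normZ c xi : norm_sec (c *: xi) = `|c| * norm_sec xi.
Proof.
have le_scale d (eta : Gam) : norm_sec (d *: eta) <= `|d| * norm_sec eta.
  apply: norm_sec_le; first by rewrite mulr_ge0.
  by move=> x; rewrite /ev secZE hmZr normrM ler_wpM2l// ev_ub.
have [->|c0] := eqVneq c 0.
  by apply/eqP; rewrite eq_le le_scale normr0 mul0r norm_sec_ge0.
apply/eqP; rewrite eq_le le_scale/= -ler_pdivlMl ?normr_gt0// -normfV.
by rewrite -{1}[xi]scale1r -(mulVf c0) -scalerA; exact: le_scale.
Qed.

Let norm0 xi : norm_sec xi = 0 -> xi = 0.
Proof.
move=> n0; apply: sectionP => x; rewrite [LHS]uvecE.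
have -> : hm (uvec x) (xi x) = 0.
  by apply/eqP; rewrite -normr_le0 -n0; exact: ev_ub.
by rewrite scale0r.
Qed.

HB.instance Definition _ := Lmodule_isNormed.Build R[i] Gam normD normZ norm0.

Lemma uniform_limit_section (l : X -> R[i]) :
  (forall e, 0 < e -> exists xi, forall x, `|ev x xi - l x| <= e) ->
  continuous (fun x => fibre_incl (l x *: uvec x)).
Proof.
move=> lP x0.
have [U [oU Ux [g [h [gc hc gK hK glin]]]]] := locally_trivial V x0.
have nU : \forall y \near x0, U y by exact: open_nbhs_nbhs.
set s := fun x => l x *: uvec x.
have hc1 : {for x0, continuous (fun y => h (y, 1))}.
  apply: (within_comp_continuous hc (phi := fun y : X => (y, 1 : R[i]))).
    by apply: filterS nU => y.
  exact: (cvg_pair (@cvg_id _ (nbhs x0)) (@cvg_cst _ (1 : R[i]) _ (nbhs x0) _)).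
have hermc (t : X -> total_space V) : {for x0, continuous t} ->
    (\forall y \near x0, bundle_proj (t y) = y) ->
    {for x0, continuous (fun y => herm (h (y, 1)) (t y))}.
  move=> tc tp; apply: (within_comp_continuous (@herm_continuous _ _ V)
    (phi := fun y => (h (y, 1), t y))).
    by apply: filterS2 nU tp => y Uy ty /=; rewrite ty (hK _ 1 Uy).1.
  exact: (cvg_pair hc1 tc).
pose a y := herm (h (y, 1)) (h (y, 1)).
have ac : {for x0, continuous a}.
  by apply: hermc => //; apply: filterS nU => y Uy; rewrite (hK _ 1 Uy).1.
pose b y := herm (h (y, 1)) (fibre_incl (s y)).
have bE y : U y -> exists2 k : R[i], a y = `|k| ^+ 2 &
    forall v : fibre V y, herm (h (y, 1)) (fibre_incl v) = k^* * hm (uvec y) v.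
  move=> Uy; have [e [eE eP]] := chart_frame gK hK glin Uy.
  exists (hm (uvec y) e); first by rewrite /a -eE normCKC -hm_uvec.
  by move=> v; rewrite -eE -hm_uvec.
have gE y : U y -> b y = g (fibre_incl (s y)) * a y.
  move=> Uy; have [e [eE eP]] := chart_frame gK hK glin Uy.
  by rewrite /b /a -eE {1}[s y]eP; exact: hmZr.
have a0 y : U y -> a y != 0.
  move=> Uy; have [e [eE eP]] := chart_frame gK hK glin Uy.
  apply/eqP; rewrite /a -eE => /herm_eq0 e0; have := (hK y 1 Uy).2.
  rewrite -eE e0 (chart0 glin Uy) => /esym/eqP; exact/negP/oner_neq0.
have bc : {for x0, continuous b}.
  apply/(@cvgrPdist_le _ _ _ (nbhs x0)) => e e0.
  set M := sqrtC (`|a x0| + 1).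
  have M0 : 0 < M by rewrite sqrtC_gt0 ltr_wpDl.
  have e3 : 0 < e / 3 by rewrite divr_gt0 ?ltr0n.
  have [xi xiP] := lP (e / 3 / M) (divr_gt0 e3 M0).
  have bxic : {for x0, continuous (fun y => herm (h (y, 1)) (fibre_incl (xi y)))}.
    apply: hermc; first exact: sec_continuous.
    by apply: nearW => y; rewrite bundle_proj_fibre_incl.
  have close y : U y -> `|a y| <= `|a x0| + 1 ->
      `|herm (h (y, 1)) (fibre_incl (xi y)) - b y| <= e / 3.
    move=> Uy ay; have [k ak kE] := bE y Uy.
    rewrite /b !kE -mulrBr normrM norm_conjC hmZr uvec1 mulr1.
    have -> : e / 3 = M * (e / 3 / M) by rewrite [RHS]mulrC mulfVK// gt_eqF.
    apply: ler_pM => //; last exact: xiP.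
    rewrite -(@ler_pXn2r _ 2) ?nnegrE ?(ltW M0)// sqrtCK.
    by move: ay; rewrite ak normrX normr_id.
  have na : \forall y \near x0, `|a y| <= `|a x0| + 1.
    have := ac => /(@cvgrPdist_le _ _ _ (nbhs x0)) /(_ 1 ltr01).
    apply: filterS => y ay; rewrite -lerBlDl (le_trans (lerB_dist _ _))//.
    by rewrite distrC.
  have := bxic => /(@cvgrPdist_le _ _ _ (nbhs x0)) /(_ _ e3) nb.
  apply: (@filter_app _ (nbhs x0) _ _ _ _ nb).
  apply: (@filter_app _ (nbhs x0) _ _ _ _ na).
  apply: filterS nU => y Uy ay by_.
  have -> : b x0 - b y =
      - (herm (h (x0, 1)) (fibre_incl (xi x0)) - b x0) +
      (herm (h (x0, 1)) (fibre_incl (xi x0)) - herm (h (y, 1)) (fibre_incl (xi y))) +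
      (herm (h (y, 1)) (fibre_incl (xi y)) - b y) by ring.
  have -> : e = e / 3 + e / 3 + e / 3 by field.
  rewrite (le_trans (ler_normD _ _))// lerD ?close//.
  by rewrite (le_trans (ler_normD _ _))// lerD// normrN close// (nbhs_singleton na).
apply/(chart_continuousP oU gc hc gK s Ux).
have gsE y : U y -> g (fibre_incl (s y)) = b y * (a y)^-1.
  by move=> Uy; rewrite gE// mulfK// a0.
apply: (@cvg_trans _ ((fun y => b y * (a y)^-1) @ nbhs x0)).
  by apply: near_eq_cvg; apply: filterS nU => y Uy; rewrite gsE.
rewrite (gsE _ Ux).
have avc : (a y)^-1 @[y --> nbhs x0] --> (a x0)^-1.
  exact: (@cvgV R[i] _ (nbhs x0) _ a (a x0) (a0 x0 Ux) ac).
exact: (@cvgM R[i] _ (nbhs x0) _ b (fun y => (a y)^-1) (b x0) (a x0)^-1 bc avc).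
Qed.

Let sections_complete (F : set_system Gam) : ProperFilter F -> cauchy F -> cvg F.
Proof.
apply: (@sup_norm_complete R X Gam ev).
- by move=> x xi eta; rewrite /ev secBE hmBr.
- by move=> x xi; exact: ev_ub.
- by move=> xi M; exact: norm_sec_le.
- move=> l /uniform_limit_section lc; exists (CSection lc : Gam) => x.
  by rewrite /ev /= hmZr uvec1 mulr1.
Qed.

HB.instance Definition _ := Uniform_isComplete.Build Gam sections_complete.

Let mulsDl f : {morph muls^~ f : xi eta / xi + eta}.
Proof. by move=> xi eta; apply: sectionP => x; exact: scalerDr. Qed.
Let mulsDr xi : {morph muls xi : f g / f + g}.
Proof. by move=> f g; apply: sectionP => x; exact: scalerDl. Qed.
Let mulsZl c xi f : muls (c *: xi) f = c *: muls xi f.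
Proof.
apply: sectionP => x.
by have E a b (v : fibre V x) : a *: (b *: v) = b *: (a *: v);
  [rewrite !scalerA mulrC | exact: E].
Qed.
Let mulsZr c xi f : muls xi (c *: f) = c *: muls xi f.
Proof. by apply: sectionP => x; apply/esym; exact: scalerA. Qed.
Let mulsM xi f g : muls xi (f ** g) = muls (muls xi f) g.
Proof.
apply: sectionP => x.
by have E a b (v : fibre V x) : (a * b) *: v = b *: (a *: v);
  [rewrite scalerA mulrC | exact: E].
Qed.
Let ipsDr xi : {morph ips xi : eta zeta / eta + zeta}.
Proof. by move=> eta zeta; apply: contC_eqP => x; exact: hmDr. Qed.
Let ipsZr c xi eta : ips xi (c *: eta) = c *: ips xi eta.
Proof. by apply: contC_eqP => x; exact: hmZr. Qed.
Let ips_muls xi eta f : ips xi (muls eta f) = ips xi eta ** f.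
Proof.
by apply: contC_eqP => x; exact: etrans (hmZr _ _ _) (mulrC _ _).
Qed.
Let star_ips xi eta : star (ips xi eta) = ips eta xi.
Proof. by apply: contC_eqP => x; apply/esym; exact: hm_sym. Qed.
Let ips_ge0 xi : exists f : CX, ips xi xi = star f ** f.
Proof.
pose r x := (Num.sqrt (complex.Re (ips xi xi x)))%:C.
have rc : continuous r.
  move=> x; apply: (@continuous_comp _ _ _
    (fun x => Num.sqrt (complex.Re (ips xi xi x))) (fun t : R => t%:C)).
    apply: (@continuous_comp _ _ _ (fun x => complex.Re (ips xi xi x)) Num.sqrt).
      apply: (@continuous_comp _ _ _ (ips xi xi) (@complex.Re R)).
        exact: contC_cts.
      exact: Re_continuous.
    exact: sqrt_continuous.
  exact: real_complex_continuous.
exists (mkC cptX rc); apply: contC_eqP => x.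
have p0 : 0 <= ips xi xi x by rewrite sqr_ev exprn_ge0.
have R0 : 0 <= complex.Re (ips xi xi x) by rewrite -lecR -complex_ge0E.
transitivity ((r x)^* * r x); last by [].
rewrite -normCKC ger0_norm ?lecR ?sqrtr_ge0// -rmorphXn/= sqr_sqrtr//.
exact: complex_ge0E.
Qed.
Let ips_eq0 xi : ips xi xi = 0 -> xi = 0.
Proof.
move=> xi0; apply: sectionP => x; apply: herm_eq0.
exact: (congr1 (fun f : CX => f x) xi0).
Qed.
Let sqr_norm_ips xi : `|xi| ^+ 2 = `|ips xi xi|.
Proof. exact: sqrtCK. Qed.

HB.instance Definition _ := isHilbertModule.Build R CX Gam
  mulsDl mulsDr mulsZl mulsZr mulsM ipsDr ipsZr ips_muls star_ips ips_ge0
  ips_eq0 sqr_norm_ips.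

Variable alpha : homeomorphism X.

Lemma comp_cts f : continuous (f \o alpha).
Proof.
move=> x; apply: continuous_comp; first exact: homeo_continuous.
exact: contC_cts.
Qed.

Definition compC f : CX := mkC cptX (@comp_cts f).

Let lacts f xi : Gam := ract xi (compC f).
Let lacts_linear xi : linear (lacts^~ xi).
Proof.
move=> c f g; apply: sectionP => x.
exact: etrans (scalerDl _ _ _) (congr1 (+%R^~ _) (esym (scalerA _ _ _))).
Qed.
Let lactsM f g xi : lacts (f ** g) xi = lacts f (lacts g xi).
Proof. by apply: sectionP => x; apply/esym; exact: scalerA. Qed.
Let lacts_star f : adjoint_of (lacts f) (lacts (star f)).
Proof.
move=> xi eta; apply: contC_eqP => x.
by rewrite /=; apply: etrans (hmZl _ _ _) _; apply/esym; exact: hmZr.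
Qed.

(* Gamma(V, alpha): the left action of f is xi |-> xi (f o alpha). *)
Definition twisted_sections : correspondence CX :=
  Correspondence lacts_linear lactsM lacts_star.

Lemma contC_mulE (f g : CX) x : (f ** g) x = f x * g x. Proof. by []. Qed.
Lemma contC_starE (f : CX) x : (star f) x = (f x)^*. Proof. by []. Qed.
Lemma sections_ractE (xi : Gam) f x : (ract xi f : Gam) x = f x *: xi x.
Proof. by []. Qed.
Lemma sections_ipE (xi eta : Gam) x :
  (ip xi eta : CX) x = herm (fibre_incl (xi x)) (fibre_incl (eta x)).
Proof. by []. Qed.
Lemma sections_normE (xi : Gam) : `|xi| = sqrtC `|ip xi xi : CX|.
Proof. by []. Qed.
Lemma twisted_sections_lactE f (xi : Gam) x :
  (lact (c:=twisted_sections) f xi : Gam) x = f (alpha x) *: xi x.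
Proof. by []. Qed.

End sections_instances.

(* Main.v *)
Require Import Defs.
From mathcomp Require Import all_boot all_order all_algebra.
From mathcomp Require Import all_classical all_reals topology normedtype.
From mathcomp Require Import sequences realfun complex ring zify.

Set Implicit Arguments.
Unset Strict Implicit.
Unset Printing Implicit Defensive.
Import Order.TTheory GRing.Theory Num.Theory numFieldNormedType.Exports.
Local Open Scope classical_set_scope.
Local Open Scope ring_scope.

(** The idea is the one for crossed products of [C(X)] by a minimal
    homeomorphism: an invariant state of [C(X)], composed with the conditional
    expectation [E] of [O] onto [C(X)], is a faithful trace. If [v] is an
    isometry of [M_n(O)], the projection [q = 1 - v v^*] has trace zero, the
    traces of the positive diagonal entries of [q = q^* q] add up to it and
    hence are zero, and faithfulness gives [q = 0] ([stably_finite_of_traces]).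

    Sections [eta_1, ..., eta_m] of the line bundle with
    [\sum_l `|eta_l|^2 = 1] ([exists_frame]) replace the unitary that
    implements the homeomorphism when the bundle is trivial: their images [t_l]
    satisfy [\sum_l t_l t_l^* = \sum_l t_l^* t_l = 1]. By minimality, if [pi]
    kills a nonzero function it kills an invertible one, and then [O = 0];
    otherwise [pi] is isometric ([injective_isometry]).

    Multiplication of [tau] by a complex number [z] of modulus one extends, by
    universality, to an endomorphism [rho] of [O], which is contractive
    ([star_hom_norm_le]). One [z] that is not a root of unity suffices: the
    means of the powers of [rho] converge to [E], since they do so on the dense
    span of the words in [pi] and [tau] ([words_total],
    [expectation_exists]). The function [E (a^* a)] is nonnegative, because it
    is a sum of squares of the homogeneous components when [a] has finitely
    many of them ([expectation_square_ge0]). If it vanishes, then so do all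
    Fourier coefficients of [a], by Cauchy-Schwarz, and [a = 0] because the
    Fejer means of [a] approximate [a] ([expectation_faithful]).

    In place of the integral against an invariant measure stand the means along
    the first [N] points of an orbit. They become invariant as [N] grows, so
    that commutators have asymptotic trace zero ([commutator_trace_cvg0]), and a
    nonnegative function whose orbit means tend to zero vanishes by minimality
    ([orbit_mean_faithful]). *)

(** * C*-algebras *)

Section complex_numbers.
Variable R : realType.

Lemma complex_ge0_closed (y : R[i]) :
  (forall e, 0 < e -> exists2 p, 0 <= p & `|y - p| <= e) -> 0 <= y.
Proof.
move=> yP.
have lim (d : R) : 0 < d -> `|complex.Im y| <= d /\ - complex.Re y <= d.
  move=> d0; have [|p p0 yp] := yP d%:C%C; first by rewrite ltcR.
  have pI : complex.Im p = 0 by rewrite (complex_ge0E p0).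
  have pR : 0 <= complex.Re p.
    by rewrite -lecR -complex_ge0E.
  split.
    rewrite -lecR; apply: le_trans yp; apply: le_trans (norm_Im_le _).
    by rewrite raddfB/= pI subr0.
  rewrite -lecR; apply: le_trans yp; apply: le_trans (normc_ge_Re _).
  rewrite lecR raddfB/= -normrN (le_trans _ (ler_norm _))// opprB lerBrDr.
  by rewrite addrC subrr.
have y0 : complex.Im y = 0.
  apply/eqP; rewrite -normr_le0; apply/ler_addgt0Pr => d d0; rewrite add0r.
  by have [] := lim d d0.
rewrite lecE/= y0 eqxx/= -oppr_le0.
by apply/ler_addgt0Pr => d d0; rewrite add0r; have [] := lim d d0.
Qed.

End complex_numbers.

Section algebra.
Variables (R : realType) (A : cstarAlgType R).
Implicit Types (a b : A) (c : R[i]).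

Lemma cmul0l a : 0 ** a = 0 :> A.
Proof. by have := cmulZl 0 (0 : A) a; rewrite !scale0r. Qed.

Lemma cmul0r a : a ** 0 = 0 :> A.
Proof. by have := cmulZr 0 a (0 : A); rewrite !scale0r. Qed.

Lemma cmulNl a b : - a ** b = - (a ** b).
Proof. by rewrite -scaleN1r cmulZl scaleN1r. Qed.

Lemma cmulNr a b : a ** - b = - (a ** b).
Proof. by rewrite -scaleN1r cmulZr scaleN1r. Qed.

Lemma cmulBl a b d : (a - b) ** d = a ** d - b ** d.
Proof. by rewrite cmulDl cmulNl. Qed.

Lemma cmulBr a b d : d ** (a - b) = d ** a - d ** b.
Proof. by rewrite cmulDr cmulNr. Qed.

Lemma cmul_suml I (r : seq I) (P : pred I) (F : I -> A) b :
  (\sum_(i <- r | P i) F i) ** b = \sum_(i <- r | P i) F i ** b.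
Proof.
apply: (big_morph (fun a => a ** b)); last exact: cmul0l.
by move=> x y; exact: cmulDl.
Qed.

Lemma cmul_sumr I (r : seq I) (P : pred I) (F : I -> A) b :
  b ** (\sum_(i <- r | P i) F i) = \sum_(i <- r | P i) b ** F i.
Proof.
apply: (big_morph (fun a => b ** a)); last exact: cmul0r.
by move=> x y; exact: cmulDr.
Qed.

Lemma star0 : star (0 : A) = 0.
Proof. by have := starZ 0 (0 : A); rewrite rmorph0 !scale0r. Qed.

Lemma starN a : star (- a) = - star a.
Proof. by rewrite -scaleN1r starZ rmorphN1 scaleN1r. Qed.

Lemma starB a b : star (a - b) = star a - star b.
Proof. by rewrite starD starN. Qed.

Lemma star_sum I (r : seq I) (P : pred I) (F : I -> A) :
  star (\sum_(i <- r | P i) F i) = \sum_(i <- r | P i) star (F i).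
Proof. apply: (big_morph (@star R A)); [exact: starD | exact: star0]. Qed.

Lemma norm_star a : `|star a| = `|a|.
Proof.
suff le b : `|b| <= `|star b| by apply: le_anti; rewrite -{2}[a]starK !le.
have [->|b0] := eqVneq b 0; first by rewrite star0.
by rewrite -(ler_pM2r (x := `|b|)) ?normr_gt0// -expr2 -norm_cstar norm_cmul_le.
Qed.

Lemma cstar_eq0 a : star a ** a = 0 -> a = 0.
Proof.
move=> a0; apply/eqP; rewrite -normr_eq0.
by have := norm_cstar a; rewrite a0 normr0 => /esym/eqP; rewrite expf_eq0.
Qed.

Lemma identity_star e : is_identity e -> star e = e :> A.
Proof.
move=> eP; have : star (star e ** e) = star e ** e by rewrite starM starK.
by rewrite (eP _).2 starK.
Qed.

Section limits.
Context {T : Type} {F : set_system T} {FF : Filter F}.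

Lemma cvg_cmul (f g : T -> A) a b :
  f @ F --> a -> g @ F --> b -> (fun x => f x ** g x) @ F --> a ** b.
Proof.
move=> fa gb; apply/cvgrPdist_le; move/cvgrPdist_le: fa => fa.
move/cvgrPdist_le : gb => gb e e0.
pose M := `|a| + `|b| + 1.
have M0 : 0 < M by rewrite ltr_wpDl ?addr_ge0.
have eM0 : 0 < e / M / 2 by rewrite !divr_gt0.
near=> x.
have -> : a ** b - f x ** g x = (a - f x) ** g x + a ** (b - g x).
  by rewrite cmulBl cmulBr [RHS]addrC addrA subrK.
have gxb : `|g x| <= M.
  rewrite -[g x](subrK b) (le_trans (ler_normD _ _))// addrC /M -addrA.
  rewrite ler_wpDl// lerD2l distrC.
  by near: x; exact: gb.
rewrite (le_trans (ler_normD _ _))//.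
rewrite (_ : e = e / M / 2 * M + M * (e / M / 2)); last by field; rewrite gt_eqF.
rewrite lerD// (le_trans (norm_cmul_le _ _))// ler_pM//.
- by near: x; exact: fa.
- by rewrite /M -addrA lerDl addr_ge0.
- by near: x; exact: gb.
Unshelve. all: by end_near. Qed.

Lemma cvg_star (f : T -> A) a : f @ F --> a -> (fun x => star (f x)) @ F --> star a.
Proof.
move=> fa; apply/cvgrPdist_le => e e0; move/cvgrPdist_le: fa => /(_ e e0).
by apply: filterS => x; rewrite -starB norm_star.
Qed.

End limits.

End algebra.

Section star_hom_lemmas.
Variables (R : realType) (A B : cstarAlgType R) (f : A -> B).
Hypothesis fH : star_hom f.

Lemma star_homM a b : f (a ** b) = f a ** f b. Proof. by case: fH. Qed.
Lemma star_homV a : f (star a) = star (f a). Proof. by case: fH. Qed.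
Lemma star_homD a b : f (a + b) = f a + f b.
Proof. by case: fH => l _ _; have := l 1 a b; rewrite !scale1r. Qed.
Lemma star_hom0 : f 0 = 0.
Proof. by apply: (@addrI _ (f 0)); rewrite -star_homD !addr0. Qed.
Lemma star_homZ c a : f (c *: a) = c *: f a.
Proof. by case: fH => l _ _; have := l c a 0; rewrite star_hom0 !addr0. Qed.
Lemma star_homB a b : f (a - b) = f a - f b.
Proof. by rewrite star_homD -scaleN1r star_homZ scaleN1r. Qed.
Lemma star_hom_sum I (r : seq I) (P : pred I) (F : I -> A) :
  f (\sum_(i <- r | P i) F i) = \sum_(i <- r | P i) f (F i).
Proof. apply: (big_morph f); [exact: star_homD | exact: star_hom0]. Qed.

End star_hom_lemmas.

(** * Contractivity of *-homomorphisms *)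

Section geometric.
Variable R : realType.

Lemma near_expr_lt (r e : R[i]) : 0 <= r -> r < 1 -> 0 < e ->
  \forall n \near \oo, r ^+ n < e.
Proof.
move=> r0 r1 /complex_gt0E[-> e0].
have rE := complex_ge0E r0; rewrite rE.
have s1 : `|complex.Re r| < 1.
  by rewrite ger0_norm -?ltcR -?rE// -lecR -rE.
move/cvg_expr/cvgrPdist_lt/(_ _ e0): s1; apply: filterS => n.
rewrite sub0r normrN -rmorphXn/= ltcR; exact/le_lt_trans/ler_norm.
Qed.

Lemma geometric_cvg (V : completeNormedModType R[i]) (u : nat -> V) (r C : R[i]) :
  0 <= r -> r < 1 -> 0 <= C -> (forall n, `|u n.+1 - u n| <= C * r ^+ n) ->
  exists l : V, u @ \oo --> l.
Proof.
move=> r0 r1 C0 uC.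
have r1' : 0 < 1 - r by rewrite subr_gt0.
have tele n k : `|u (n + k)%N - u n| <= C * r ^+ n * (1 - r ^+ k) / (1 - r).
  elim: k => [|k IH]; first by rewrite addn0 expr0 !subrr normr0 mulr0 mul0r.
  have -> : u (n + k.+1)%N - u n = (u (n + k).+1 - u (n + k)%N) + (u (n + k)%N - u n).
    by rewrite addnS addrA subrK.
  rewrite (le_trans (ler_normD _ _))// (le_trans (lerD (uC _) IH))//.
  rewrite exprD exprS le_eqVlt; apply/orP; left; apply/eqP; field.
  by rewrite gt_eqF.
have UF := @fmap_proper_filter _ _ u \oo eventually_filter.
suff uc : cauchy (u @ \oo).
  by have /cvg_ex[l ul] := @cauchy_cvg V _ UF uc; exists l.
apply: cauchy_exP => e e0.
have e1 : 0 < e * (1 - r) / (C + 1) by rewrite divr_gt0 ?mulr_gt0// ltr_wpDl.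
have [n _ nP] := near_expr_lt r0 r1 e1.
exists (u n); rewrite /= -ball_normE; exists n => // m /= nm.
rewrite -(subnKC nm) distrC (le_lt_trans (tele _ _))//.
have rn : r ^+ n < e * (1 - r) / (C + 1) by apply: nP => /=.
rewrite ltr_pdivrMr//; apply: (@le_lt_trans _ _ (C * r ^+ n)).
  by rewrite ler_piMr ?mulr_ge0 ?exprn_ge0// gerDl oppr_le0 exprn_ge0.
apply: (@le_lt_trans _ _ ((C + 1) * r ^+ n)).
  by rewrite ler_wpM2r ?exprn_ge0// lerDl.
by rewrite mulrC -ltr_pdivlMr ?ltr_wpDl.
Qed.

Lemma cvg_eq (V : normedModType R[i]) (u v : nat -> V) (a b : V) :
  u @ \oo --> a -> v @ \oo --> b -> u =1 v -> a = b.
Proof.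
move=> ua vb /funext uv; rewrite -uv in vb.
exact: (cvg_unique (@norm_hausdorff _ V) ua vb).
Qed.

Lemma cvg_norm_le (V : normedModType R[i]) (u : nat -> V) (a : V) (M : R[i]) :
  u @ \oo --> a -> (\forall n \near \oo, `|u n| <= M) -> `|a| <= M.
Proof.
move=> ua uM; apply/ler_addgt0Pr => e e0; move/cvgrPdist_le: ua => /(_ e e0) ua.
have [y [ay My]] := filter_ex (filterI ua uM).
rewrite -[a](subrK (u y)) addrC.
by rewrite (le_trans (ler_normD _ _))// addrC [leRHS]addrC lerD.
Qed.

Lemma cvg_sumr (V : normedModType R[i]) I (r : seq I) (F : I -> nat -> V) (l : I -> V) :
  (forall i, F i @ \oo --> l i) ->
  (fun n => \sum_(i <- r) F i n) @ \oo --> \sum_(i <- r) l i.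
Proof.
move=> Fl; elim: r => [|i r IH].
  by rewrite big_nil; under eq_cvg do rewrite big_nil; exact: cvg_cst.
by rewrite big_cons; under eq_cvg do rewrite big_cons; exact: cvgD (Fl i) IH.
Qed.

End geometric.

Section contractive.
Variables (R : realType) (A B : cstarAlgType R) (e : A).
Hypothesis eP : is_identity e.

(** A square root of [1 - h^2], as [1 - y] with [y] the fixed point of the
    contraction [y |-> (h^2 + y^2) / 2] of the ball of radius [|h|]. *)
Lemma sqrt_one_sub_sqr (h : A) : star h = h -> `|h| < 1 ->
  exists t, [/\ star t = t, t ** h = h ** t & t ** t = e - h ** h].
Proof.
move=> hs h1; pose F (y : A) := 2^-1 *: (h ** h + y ** y).
have h0 : 0 <= `|h| by [].
have FE y z : F y - F z = 2^-1 *: (y ** (y - z) + (y - z) ** z).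
  by rewrite /F -scalerBr cmulBr cmulBl addrA subrK opprD addrACA subrr add0r.
have half : `|2^-1 : R[i]| = 2^-1 by rewrite ger0_norm ?invr_ge0.
have Fb y : `|y| <= `|h| -> `|F y| <= `|h|.
  move=> yh; rewrite normrZ half ler_pdivrMl// mulr_natl mulr2n.
  rewrite (le_trans (ler_normD _ _))// lerD// (le_trans (norm_cmul_le _ _))//.
    by rewrite ler_piMr ?(ltW h1).
  by rewrite (le_trans (ler_pM _ _ yh yh))// ler_piMr ?(ltW h1).
pose y n := iter n F 0.
have yb n : `|y n| <= `|h| by elim: n => [|n IH]; rewrite /= ?normr0 ?Fb.
have [|l yl] := @geometric_cvg R A y _ 1 h0 h1 ler01.
  elim=> [|n IH].
    by rewrite subr0 expr0 mulr1 (le_trans (yb 1%N))// ltW.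
  rewrite [y n.+2]/= -/(F (y n.+1)) [X in _ - X]/= FE normrZ half ler_pdivrMl//.
  rewrite (le_trans (ler_normD _ _))// mulr_natl mulr2n exprS mulrCA.
  rewrite lerD ?(le_trans (norm_cmul_le _ _))//.
    by rewrite ler_pM// (yb n.+1).
  by rewrite mulrC ler_pM.
have yS : (fun n => y n.+1) @ \oo --> l by move: yl; rewrite -cvg_shiftS.
have lF : l = F l.
  apply: (cvg_eq yS (v := fun n => F (y n))) => //.
  apply: cvgZr; apply: cvgD; [exact: cvg_cst | exact: (cvg_cmul yl yl)].
have ls : star l = l.
  apply: (cvg_eq (cvg_star yl) yl) => n.
  elim: n => [|n IH]; first by rewrite /= star0.
  rewrite /= -/(y n) starZ starD !starM hs IH; congr (_ *: _).
  by apply: conj_Creal; rewrite ger0_real ?invr_ge0.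
have lh : l ** h = h ** l.
  apply: (cvg_eq (u := fun n => y n ** h) (v := fun n => h ** y n)).
  - exact: (cvg_cmul (g := fun=> h) yl (cvg_cst h)).
  - exact: (cvg_cmul (f := fun=> h) (cvg_cst h) yl).
  - elim=> [|n IH]; first by rewrite /= cmul0l cmul0r.
    rewrite /= -/(y n) cmulZl cmulZr cmulDl cmulDr cmulA; congr (_ *: (_ + _)).
    by rewrite -cmulA IH cmulA IH cmulA.
exists (e - l); split.
- by rewrite starB ls identity_star.
- by rewrite cmulBl cmulBr lh (eP h).1 (eP h).2.
- rewrite cmulBl !cmulBr !(eP _).1 (eP _).2.
  have : l + l = h ** h + l ** l.
    by rewrite {1 2}lF -mulr2n -scaler_nat scalerA divff ?scale1r// pnatr_eq0.
  move=> E; have -> : h ** h = l + l - l ** l by rewrite E addrK.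
  by rewrite -[l + l - _]addrA [in RHS]opprD addrA.
Qed.

(** Selfadjoint elements of norm less than one are real parts of unitaries,
    and *-homomorphisms map unitaries to elements of norm at most one. *)
Lemma star_hom_norm_le (f : A -> B) a : star_hom f -> `|f a| <= `|a|.
Proof.
move=> fH.
have fe : `|f e| <= 1.
  have := norm_cstar (f e); rewrite -star_homV// -star_homM// (identity_star eP) (eP e).1.
  have [->|fe0] := eqVneq (f e) 0; first by rewrite normr0.
  rewrite expr2 -{1}[`|f e|]mul1r => /mulIf; rewrite normr_eq0 => /(_ fe0) <-.
  exact: lexx.
have lt1 h : star h = h -> `|h| < 1 -> `|f h| <= 1.
  move=> hs h1; have [t [ts th tt]] := sqrt_one_sub_sqr hs h1.
  pose u := h + 'i *: t.
  have us : star u = h - 'i *: t by rewrite starD starZ hs ts conjCi scaleNr.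
  have uu : star u ** u = e.
    rewrite us cmulBl !cmulDr !cmulZl !cmulZr th tt scalerA -expr2 sqrCi scaleN1r.
    by rewrite opprD opprK addrA addrK addrCA subrr addr0.
  have u1 : `|f u| <= 1.
    by rewrite -(@ler_pXn2r _ 2) ?nnegrE// expr1n -norm_cstar -star_homV// -star_homM// uu.
  have -> : f h = 2^-1 *: (f u + star (f u)).
    rewrite -star_homV// -star_homD// us /u addrACA subrr addr0 -star_homZ//.
    by rewrite -[h + h]mulr2n -[h *+ 2]scaler_nat scalerA mulVf ?scale1r ?pnatr_eq0.
  rewrite normrZ ger0_norm ?invr_ge0// ler_pdivrMl// mulr1.
  by rewrite (le_trans (ler_normD _ _))// norm_star -[2]/(1 + 1) lerD.
have sa h : star h = h -> `|f h| <= `|h|.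
  move=> hs; apply/ler_addgt0Pr => d d0.
  have k0 : 0 < `|h| + d by rewrite ltr_wpDl.
  have kc : ((`|h| + d)^-1)^* = (`|h| + d)^-1.
    by apply: conj_Creal; rewrite ger0_real ?invr_ge0 ?ltW.
  have := lt1 ((`|h| + d)^-1 *: h); rewrite starZ hs kc star_homZ// !normrZ.
  rewrite ger0_norm ?invr_ge0 ?(ltW k0)// ltr_pdivrMl// mulr1 ler_pdivrMl// mulr1.
  by apply=> //; rewrite ltrDl.
rewrite -(@ler_pXn2r _ 2) ?nnegrE// -!norm_cstar -star_homV// -star_homM//.
by apply: sa; rewrite starM starK.
Qed.

End contractive.

(** * Continuous functions and frames of line bundles *)

Section compact_functions.
Variables (R : realType) (X : topologicalType) (cptX : compact [set: X]).
Notation CX := (contC R cptX).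

Definition constC (c : R[i]) : CX := mkC cptX (@cstC_cts R X c).

Lemma constC_identity : is_identity (constC 1).
Proof. by move=> f; split; apply: contC_eqP => x; [exact: mul1r | exact: mulr1]. Qed.

Lemma contC_sumE I (r : seq I) (P : pred I) (F : I -> CX) x :
  (\sum_(i <- r | P i) F i) x = \sum_(i <- r | P i) F i x.
Proof. by apply: (big_morph (fun f : CX => f x)). Qed.

(** Compactness, applied to the filter on finite sequences of indices that is
    generated by the sets of all extensions of a given one. *)
Lemma finite_nonvanishing (I : choiceType) (F : I -> CX) :
  (forall x, exists i, F i x != 0) -> exists s : seq I, forall x, has (fun i => F i x != 0) s.
Proof.
move=> Fn.
pose G : set_system (seq I) := @filter_from (seq I) (seq I) setT (fun s : seq I => [set t : seq I | {subset s <= t}]).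
have GF : Filter G.
  apply: filter_from_filter; first by exists [::].
  move=> s t _ _; exists (s ++ t) => // u /= stu.
  by split=> i iu; apply: stu; rewrite mem_cat iu ?orbT.
have [|s _ sP] := (compact_near_coveringP _).1 cptX _ G (fun s x => has (fun i => F i x != 0) s) GF.
  move=> x _; have [i Fi] := Fn x.
  exists ([set y | F i y != 0], [set t : seq I | i \in t]) => /=.
    split; last by exists [:: i] => // t /=; apply; rewrite mem_head.
    exact: (@cvgr_neq0 R[i] R[i] X (nbhs x) _ (F i) (F i x) (@contC_cts R X cptX (F i) x) Fi).
  by move=> [y t] /= [Fy it]; apply/hasP; exists i.
by exists s => x; exact: (sP s (fun=> id)).
Qed.

Lemma contC_inverse (f : CX) : (forall x, f x != 0) -> exists g : CX, forall x, g x = (f x)^-1.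
Proof.
move=> f0; have gc : continuous (fun x => (f x)^-1).
  move=> x; exact: (@cvgV R[i] _ (nbhs x) _ f (f x) (f0 x) (@contC_cts R X cptX f x)).
by exists (mkC cptX gc).
Qed.

Lemma contC_sqrt (f : CX) : (forall x, 0 <= f x) -> exists g : CX, forall x, 0 <= g x /\ g x ^+ 2 = f x.
Proof.
move=> f0; pose r x : R[i] := (Num.sqrt (complex.Re (f x)))%:C%C.
have rc : continuous r.
  move=> x; apply: (@continuous_comp _ _ _
    (fun x => Num.sqrt (complex.Re (f x))) (fun t : R => t%:C%C)).
    apply: (@continuous_comp _ _ _ (fun x => complex.Re (f x)) Num.sqrt).
      apply: (@continuous_comp _ _ _ f (@complex.Re R)).
        exact: contC_cts.
      exact: Re_continuous.
    exact: sqrt_continuous.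
  exact: real_complex_continuous.
exists (mkC cptX rc) => x; rewrite -[mkC cptX rc x]/(r x) /r; split.
  by rewrite lecR sqrtr_ge0.
rewrite -rmorphXn/= sqr_sqrtr -?complex_ge0E//.
by rewrite -lecR -complex_ge0E.
Qed.

End compact_functions.

Section frame.
Variables (R : realType) (X : metricType R) (cptX : compact [set: X]).
Variable V : lineBundle R X.
Notation CX := (contC R cptX).
Notation Gam := (sections cptX V).

(** Both sides are multiples of the same unit vector of the one-dimensional fibre. *)
Lemma hm_rank1 x (u v w : fibre V x) : hm u w *: v = hm u v *: w.
Proof.
rewrite [v]uvecE [w]uvecE; set a := hm (uvec V x) v; set b := hm (uvec V x) w.
by rewrite !hmZr !scalerA mulrAC [in RHS]mulrAC [a * b]mulrC.
Qed.

(** A local frame multiplied by a bump function extends by zero. *)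
Lemma exists_nonvanishing_section (x : X) : exists xi : Gam, xi x != 0.
Proof.
have [U [oU Ux [g [h [gc hc gK hK glin]]]]] := locally_trivial V x.
have [d d0 dU] : exists2 d : R, 0 < d & forall y, mdist x y < d -> U y.
  have /nbhs_ballP[d d0 dU] : nbhs x U by exact: open_nbhs_nbhs.
  by exists d => // y xy; apply: dU; rewrite ballEmdist.
have frame y : {e : fibre V y | U y -> fibre_incl e = h (y, 1)}.
  apply: cid; have [Uy|nUy] := pselect (U y); last by exists 0.
  by have [e [eE _]] := chart_frame gK hK glin Uy; exists e.
pose b (y : X) : R := (d / 2 - mdist x y) + `|d / 2 - mdist x y|.
have dc : continuous (fun y : X => d / 2 - mdist x y).
  move=> y; apply/(@cvgrPdist_lt _ _ _ (nbhs y)) => e e0; near=> z.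
  have yz : mdist y z < e.
    by near: z; apply/nbhs_ballP; exists e => // z; rewrite ballEmdist.
  rewrite opprB addrC addrA subrK; apply: le_lt_trans yz.
  rewrite ler_norml lerBrDr [- mdist y z + _]addrC lerBlDr {1}(metric_sym y z) metric_triangle/=.
  by rewrite lerBlDr addrC metric_triangle.
have bc : continuous b.
  by move=> y; apply: cvgD; [exact: dc | exact: cvg_norm (dc y)].
have b0 y : d <= mdist x y -> \forall z \near y, b z = 0.
  move=> dy; near=> z.
  have zd : d / 2 - mdist x z < 0.
    near: z; apply: (@cvgr_lt _ _ (nbhs y) _ _ _ (dc y)).
    by rewrite subr_lt0; apply: lt_le_trans dy; rewrite gtr_pMr// invf_lt1// ltr1n.
  by rewrite /b ltr0_norm// subrr.
pose bC : CX := mkC cptX (fun y => continuous_comp (bc y) (@real_complex_continuous R (b y))).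
pose s y : fibre V y := bC y *: sval (frame y).
have sc : continuous (fun y => fibre_incl (s y)).
  move=> y; have [Uy|nUy] := pselect (U y).
    apply/(chart_continuousP oU gc hc gK s Uy).
    apply: (@cvg_trans _ (bC @ nbhs y)).
      apply: near_eq_cvg; have : nbhs y U by exact: open_nbhs_nbhs.
      apply: filterS => z Uz; rewrite (chartZ glin)// (svalP (frame z) Uz).
      by rewrite (hK z 1 Uz).2 mulr1.
    rewrite (chartZ glin)// (svalP (frame y) Uy) (hK y 1 Uy).2 mulr1.
    exact: contC_cts.
  have /b0 by0 : d <= mdist x y by rewrite leNgt; apply/negP => /dU.
  have sE : s y = 0 by rewrite /s -[bC y]/((b y)%:C%C) (nbhs_singleton by0) scale0r.
  rewrite /continuous_at sE.
  apply: cvg_trans (@zero_sec R X V y); apply: near_eq_cvg.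
  by apply: filterS by0 => z z0; rewrite /s -[bC z]/((b z)%:C%C) z0 scale0r.
exists (CSection sc : Gam); apply/eqP => /= sx.
have /(congr1 (fun v => g (fibre_incl v))) := sx.
rewrite (chart0 glin)// (chartZ glin)// (svalP (frame x) Ux) (hK x 1 Ux).2 mulr1.
rewrite -[bC x]/((b x)%:C%C) /b mdistxx subr0 ger0_norm ?divr_ge0 ?ltW// -splitr.
by case=> /eqP; rewrite gt_eqF.
Unshelve. all: by end_near. Qed.

(** Finitely many sections without a common zero are divided by the square
    root of the sum of their squared lengths. Such a family stands in for a
    section of length one, which a nontrivial bundle does not have. *)
Lemma exists_frame : exists s : seq Gam, \sum_(eta <- s) ip eta eta = constC cptX 1.
Proof.
pose F (xi : Gam) : CX := ip xi xi.
have F0 xi x : 0 <= F xi x by exact: herm_ge0.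
have [x|s sP] := @finite_nonvanishing R X cptX Gam F.
  have [xi xi0] := exists_nonvanishing_section x; exists xi.
  by apply: contra xi0 => /eqP /herm_eq0 ->.
pose g : CX := \sum_(xi <- s) F xi.
have gE x : g x = \sum_(xi <- s) F xi x by exact: contC_sumE.
have g0 x : 0 < g x.
  rewrite gE lt_def sumr_ge0 => [|xi _]; last exact: F0.
  rewrite andbT psumr_neq0 => [|xi _]; last exact: F0.
  by apply: sub_has (sP x) => xi; rewrite lt_def F0 andbT.
have [r rP] := contC_sqrt (fun x => ltW (g0 x)).
have [x|q qE] := @contC_inverse R X cptX r.
  by have [_ rx] := rP x; apply: contraTneq (g0 x) => r0; rewrite -rx r0 expr0n ltxx.
exists [seq ract xi q | xi <- s]; rewrite big_map.
apply: contC_eqP => x; rewrite contC_sumE -[constC cptX 1 x]/(1 : R[i]).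
have [r0 rx] := rP x.
transitivity (\sum_(xi <- s) q x ^+ 2 * F xi x).
  apply: eq_bigr => xi _; rewrite /F !sections_ipE !sections_ractE.
  rewrite -/(hm _ _) hmZl hmZr mulrA; congr (_ * _).
  by rewrite expr2 conj_Creal// qE ger0_real// invr_ge0.
rewrite -mulr_sumr -gE qE -rx exprVn mulVf// rx gt_eqF//.
Qed.

(** Rank one operators act by multiplication by a function, by [hm_rank1]. *)
Lemma theta_lact (alpha : homeomorphism X) (xi eta : Gam) (f : CX) :
  (forall x, f (alpha x) = (ip eta xi : CX) x) ->
  theta xi eta = lact (c := twisted_sections cptX V alpha) f.
Proof.
move=> fE; apply/funext => zeta; apply: sectionP => x.
by rewrite twisted_sections_lactE fE; exact: hm_rank1.
Qed.

Lemma frame_expansion (s : seq Gam) (xi : Gam) :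
  \sum_(eta <- s) ip eta eta = constC cptX 1 ->
  xi = \sum_(eta <- s) ract eta (ip eta xi : CX).
Proof.
move=> s1; apply: sectionP => x.
have -> : (\sum_(eta <- s) ract eta (ip eta xi : CX)) x =
    \sum_(eta <- s) (ip eta eta : CX) x *: xi x.
  rewrite (big_morph (fun z : Gam => z x) (id1 := 0) (op1 := +%R))//.
  by apply: eq_bigr => eta _; exact: hm_rank1.
by rewrite -scaler_suml -contC_sumE s1 -[constC cptX 1 x]/(1 : R[i]) scale1r.
Qed.

End frame.

(** * Minimal homeomorphisms and isometric representations of functions *)

Section minimality.
Variables (R : realType) (X : topologicalType) (cptX : compact [set: X]).
Variable alpha : homeomorphism X.
Notation CX := (contC R cptX).
Implicit Types f g h : CX.

Lemma iter_compCE k h x : iter k (compC alpha) h x = h (iter k alpha x).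
Proof. by elim: k x => // k IH x; rewrite [iter k.+1 alpha x]iterSr; exact: IH. Qed.

(** The common zeros of all [h o alpha^k] form a closed set that [alpha] maps into itself. *)
Lemma minimal_finite_cover h : minimal_map alpha -> h != 0 ->
  exists s : seq nat, forall x, has (fun k => h (iter k alpha x) != 0) s.
Proof.
move=> amin h0.
have [x|s sP] := @finite_nonvanishing R X cptX nat (fun k => iter k (compC alpha) h); last first.
  by exists s => x; apply: sub_has (sP x) => k; rewrite iter_compCE.
apply: contrapT => nx.
pose E := [set y : X | forall k, iter k (compC alpha) h y = 0].
have Ex : E x by move=> k; apply: contrapT => /eqP hk; apply: nx; exists k.
have cE : closed E.
  move=> y Ey k; apply: contrapT => /eqP hk.
  have [z [Ez]] := Ey _ (@cvgr_neq0 R[i] R[i] X (nbhs y) _ _ _ (@contC_cts R X cptX (iter k (compC alpha) h) y) hk).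
  by rewrite (Ez k) eqxx.
have aE : alpha @` E `<=` E.
  by move=> _ [y Ey <-] k; have := Ey k.+1; rewrite !iter_compCE iterSr.
have [E0|ET] := amin E cE aE; first by rewrite E0 in Ex.
move/eqP: h0; apply; apply: contC_eqP => y.
have : E y by rewrite ET.
by move/(_ 0%N).
Qed.

End minimality.

Section isometry.
Variables (R : realType) (X : topologicalType) (cptX : compact [set: X]).
Notation CX := (contC R cptX).
Implicit Types f g h : CX.
Variables (B : cstarAlgType R) (pi : CX -> B).
Hypothesis piH : star_hom pi.

Lemma pi_norm_le f : `|pi f| <= `|f|.
Proof. exact: (star_hom_norm_le (@constC_identity R X cptX) f piH). Qed.

(** If [pi] shrank the norm of [g], with [0 <= g <= 1], there would be a number
    [r] with [`|pi g| < r] that [g] exceeds somewhere. The function [h] below,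
    a multiple of the positive part of [g - r], satisfies [r h = w g h] with
    [`|w| <= 1], whence [r `|pi h| <= `|pi g| `|pi h|]. *)
Lemma injective_isometry : (forall h, pi h = 0 -> h = 0) -> forall f, `|pi f| = `|f|.
Proof.
move=> inj f; apply/le_anti; rewrite pi_norm_le/=.
rewrite -(@ler_pXn2r _ 2) ?nnegrE// -!norm_cstar -star_homV// -star_homM//.
set g := star f ** f.
have g0 x : 0 <= g x by rewrite /g contC_mulE contC_starE -normCKC exprn_ge0.
rewrite real_leNgt ?ger0_real//; apply/negP => lt.
pose r := (`|pi g| + `|g|) / 2.
have [qr rg] := midf_lt lt; rewrite -/r in qr rg.
have r0 : 0 < r by exact: le_lt_trans qr.
have rr : r \is Num.real by rewrite ger0_real// ltW.
have [x gx] : exists x, r < g x.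
  apply: contrapT => ngx; move: rg; rewrite real_ltNge ?normr_real//; move/negP; apply.
  apply: contC_norm_le => [|x]; first exact: ltW.
  rewrite ger0_norm// real_leNgt //; last exact: ger0_real.
  by apply/negP => gx; apply: ngx; exists x.
pose u : CX := g - constC cptX r.
have hc : continuous (fun x => u x + `|u x|).
  move=> y; apply: cvgD; first exact: contC_cts.
  exact: (@cvg_norm R[i] R[i] X (nbhs y) _ u (u y) (@contC_cts R X cptX u y)).
pose h : CX := mkC cptX hc.
have hE y : h y = (g y - r) + `|g y - r| by [].
have h0 y : 0 <= h y.
  rewrite hE addrC -lerBlDr sub0r -normrN real_ler_norm// rpredN rpredB//.
  exact: ger0_real.
pose G : CX := constC cptX r + 2^-1 *: h.
have GE y : G y = r + 2^-1 * h y by [].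
have Gr y : r <= G y by rewrite GE lerDl mulr_ge0 ?invr_ge0.
have G0 y : G y != 0 by rewrite gt_eqF// (lt_le_trans r0).
have [w wE] := contC_inverse G0.
have hG : G ** h = g ** h.
  apply: contC_eqP => y; rewrite !contC_mulE GE hE.
  have /orP[gr|gr] := real_comparable (ger0_real (g0 y)) rr.
    by rewrite ler0_norm ?subr_le0// subrr !mulr0.
  rewrite ger0_norm ?subr_ge0// -mulr2n -[(g y - r) *+ 2]mulr_natl mulKf ?pnatr_eq0//.
  by rewrite addrC subrK.
have wG : w ** G = constC cptX 1.
  by apply: contC_eqP => y; rewrite contC_mulE wE mulVf.
have hw : h = w ** (g ** h).
  by rewrite -hG cmulA wG (constC_identity h).1.
have wr : `|w| <= r^-1.
  apply: contC_norm_le => [|y]; first by rewrite invr_ge0 ltW.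
  rewrite wE normfV ger0_norm ?(le_trans (ltW r0))//.
  by rewrite lef_pV2 ?posrE ?(lt_le_trans r0).
have ph : `|pi h| <= r^-1 * `|pi g| * `|pi h|.
  have pih : pi h = pi w ** (pi g ** pi h) by rewrite -!(star_homM piH) -hw.
  rewrite {1}pih -mulrA (le_trans (norm_cmul_le _ _))// ler_pM//.
    exact: le_trans (pi_norm_le _) wr.
  exact: norm_cmul_le.
have : `|pi h| == 0.
  rewrite eq_le normr_ge0 andbT.
  have : (1 - r^-1 * `|pi g|) * `|pi h| <= 0 by rewrite mulrBl mul1r subr_le0.
  by rewrite pmulr_rle0// subr_gt0 mulrC ltr_pdivrMr// mul1r.
rewrite normr_eq0 => /eqP/inj/(congr1 (fun k : CX => k x)); rewrite hE.
by rewrite ger0_norm ?subr_ge0 ?ltW// => /eqP; rewrite gt_eqF// addr_gt0 ?subr_gt0.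
Qed.

End isometry.

(** * Closed linear spans of words *)

Section closed_sets.
Variables (R : realType) (V : normedModType R[i]).

Lemma closed_approx (S : set V) :
  closed S <-> forall a, (forall e, 0 < e -> exists2 b, S b & `|a - b| <= e) -> S a.
Proof.
split=> [cS a aS|aS a cla].
  apply: cS => U /nbhs_ballP[e /= e0 eU].
  have [|b Sb ab] := aS (e / 2); first by rewrite divr_gt0.
  exists b; split=> //; apply: eU; rewrite -ball_normE/=.
  by apply: le_lt_trans ab _; rewrite gtr_pMr// invf_lt1// ltr1n.
apply: aS => e e0; have [|b [Sb]] := cla (ball a e); first exact: nbhsx_ballx.
by rewrite -ball_normE/= => /ltW ab; exists b.
Qed.

Definition closed_subspace (S : set V) :=
  [/\ closed S, S 0 & forall (c : R[i]) a b, S a -> S b -> S (c *: a + b)].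

Lemma closed_subspace_preimage (f : V -> V) (k : R[i]) (S : set V) :
  linear f -> 0 <= k -> (forall a, `|f a| <= k * `|a|) ->
  closed_subspace S -> closed_subspace (f @^-1` S).
Proof.
move=> fl k0 fk [cS S0 SD].
have fD c a b : f (c *: a + b) = c *: f a + f b by exact: fl.
have f0 : f 0 = 0.
  apply/eqP; rewrite -normr_eq0 eq_le normr_ge0 andbT.
  by have := fk 0; rewrite normr0 mulr0.
split=> [||c a b Sa Sb]; last by rewrite /preimage/= fD; exact: SD.
  apply/closed_approx => a aS; apply: (closed_approx S).1 => // e e0.
  have k1 : 0 < k + 1 by rewrite ltr_wpDl.
  have [|b Sb ab] := aS (e / (k + 1)); first by rewrite divr_gt0.
  exists (f b) => //; have -> : f a - f b = f (a - b).
    by rewrite [a - b]addrC -[- b]scaleN1r fD scaleN1r addrC.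
  rewrite (le_trans (fk _))// (le_trans (ler_wpM2l k0 ab))//.
  by rewrite mulrCA ler_piMr ?(ltW e0)// ler_pdivrMr// mul1r lerDl.
by rewrite /preimage/= f0.
Qed.

End closed_sets.

Section words.
Variables (R : realType) (O : cstarAlgType R).

(** With [P] a set of elements of degree one, the words of length [n] have
    degree [n]; the words in their adjoints have degree [-n]. *)
Inductive word (P A : set O) : nat -> O -> Prop :=
| word0 a : A a -> word P A 0 a
| wordS n u a : P u -> word P A n a -> word P A n.+1 (u ** a).

Variables (A T : set O).

Let Tstar : set O := [set star u | u in T].

Hypotheses (AM : forall a b, A a -> A b -> A (a ** b))
  (A_star : forall a, A a -> A (star a))
  (AT : forall a u, A a -> T u -> T (a ** u))
  (TA : forall u a, T u -> A a -> T (u ** a))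
  (TsT : forall u v, T u -> T v -> A (star u ** v))
  (TTs : forall u v, T u -> T v -> A (u ** star v)).
Variable e : O.
Hypotheses (eP : is_identity e) (Ae : A e).

Let in_span (a : O) := forall S, closed_subspace S ->
  (forall n b, word T A n b -> S b) -> (forall n b, word Tstar A n b -> S b) -> S a.

Let in_span_linear (c : R[i]) a b : in_span a -> in_span b -> in_span (c *: a + b).
Proof.
move=> aS bS S HS ST ST'; have [_ _ SD] := HS.
by apply: SD; [exact: aS | exact: bS].
Qed.

Let in_span_mull (a : O) :
  (forall n b, word T A n b -> in_span (a ** b)) ->
  (forall n b, word Tstar A n b -> in_span (a ** b)) ->
  forall b, in_span b -> in_span (a ** b).
Proof.
move=> aT aT' b bS S HS ST ST'.
have HSa : closed_subspace ((fun b => a ** b) @^-1` S).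
  apply: (@closed_subspace_preimage _ _ _ `|a|) => // [c x y|x].
    by rewrite cmulDr cmulZr.
  exact: norm_cmul_le.
by apply: (bS _ HSa) => n x xw; [exact: (aT n x xw S) | exact: (aT' n x xw S)].
Qed.

Let A_word a n b : A a -> word T A n b -> word T A n (a ** b).
Proof.
move=> Aa; case=> [x Ax|m u x Tu xw]; first by apply: word0; exact: AM.
by rewrite cmulA; apply: wordS => //; exact: AT.
Qed.

Let A_wordV a n b : A a -> word Tstar A n b -> word Tstar A n (a ** b).
Proof.
move=> Aa; case=> [x Ax|m _ x [u Tu <-] xw]; first by apply: word0; exact: AM.
rewrite cmulA; apply: wordS => //; exists (u ** star a).
  by apply: TA => //; exact: A_star.
by rewrite starM starK.
Qed.

Let span_word n b : word T A n b -> in_span b.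
Proof. by move=> bw S _ ST _; exact: ST bw. Qed.

Let span_wordV n b : word Tstar A n b -> in_span b.
Proof. by move=> bw S _ _; apply; exact: bw. Qed.

Let span_A a : A a -> forall b, in_span b -> in_span (a ** b).
Proof.
move=> Aa; apply: in_span_mull => n b bw.
  exact: span_word (A_word Aa bw).
exact: span_wordV (A_wordV Aa bw).
Qed.

Let span_T u : T u -> forall b, in_span b -> in_span (u ** b).
Proof.
move=> Tu; apply: in_span_mull => n b bw.
  exact: span_word (wordS Tu bw).
case: bw => [a Aa|m _ a [v Tv <-] aw].
  exact: span_word (wordS Tu (word0 _ Aa)).
by rewrite cmulA; exact: span_wordV (A_wordV (TTs Tu Tv) aw).
Qed.

Let span_Tstar u : T u -> forall b, in_span b -> in_span (star u ** b).
Proof.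
move=> Tu; have T'u : Tstar (star u) by exists u.
apply: in_span_mull => n b bw; last exact: span_wordV (wordS T'u bw).
case: bw => [a Aa|m v a Tv aw].
  exact: span_wordV (wordS T'u (word0 _ Aa)).
by rewrite cmulA; exact: span_word (A_word (TsT Tu Tv) aw).
Qed.

(** The elements [a] such that multiplication on the left by [a] and by [a^*]
    preserves the closed span of the words form a C*-subalgebra, which contains
    the generators. *)
Lemma words_total (S : set O) : generates (A `|` T) -> closed_subspace S ->
  (forall n b, word T A n b -> S b) -> (forall n b, word Tstar A n b -> S b) ->
  S = setT.
Proof.
move=> gen HS ST ST'; apply/seteqP; split=> // a _.
pose L := [set a : O | forall b, in_span b -> in_span (a ** b) /\ in_span (star a ** b)].
suff LT : L = setT.
  have La : L a by rewrite LT.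
  have [] := La e; last by rewrite (eP a).2 => + _; apply.
  exact: span_word (word0 T Ae).
apply: gen => [|x [Ax|Tx] b bS]; last 2 first.
- by split; apply: span_A => //; exact: A_star.
- by split; [exact: span_T | exact: span_Tstar].
split.
- apply/closed_approx => x xL b bS.
  split=> S' HS' S'T S'T'; have [cS' _ _] := HS';
    apply: (closed_approx S').1 => // d d0; have b1 : 0 < `|b| + 1 by rewrite ltr_wpDl.
  + have [|y Ly xy] := xL (d / (`|b| + 1)); first by rewrite divr_gt0.
    exists (y ** b); first by have [yb _] := Ly b bS; exact: yb.
    rewrite -cmulBl (le_trans (norm_cmul_le _ _))// (le_trans (ler_wpM2r _ xy))//.
    by rewrite mulrAC -mulrA ler_piMr ?(ltW d0)// ler_pdivrMr// mul1r lerDl.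
  + have [|y Ly xy] := xL (d / (`|b| + 1)); first by rewrite divr_gt0.
    exists (star y ** b); first by have [_ yb] := Ly b bS; exact: yb.
    rewrite -cmulBl -starB (le_trans (norm_cmul_le _ _))// norm_star.
    rewrite (le_trans (ler_wpM2r _ xy))//.
    by rewrite mulrAC -mulrA ler_piMr ?(ltW d0)// ler_pdivrMr// mul1r lerDl.
- by move=> b bS; rewrite star0 !cmul0l; split=> S' [].
- move=> c x y Lx Ly b bS; have [xb x'b] := Lx b bS; have [yb y'b] := Ly b bS.
  by rewrite starD starZ !cmulDl !cmulZl; split; exact: in_span_linear.
- move=> x y Lx Ly b bS; rewrite starM -!cmulA; split.
    by apply: (Lx _ _).1; exact: (Ly b bS).1.
  by apply: (Ly _ _).2; exact: (Lx b bS).2.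
- by move=> x Lx b bS; rewrite starK; have [? ?] := Lx b bS.
Qed.

End words.

(** * Means of powers, Fejer coefficients and orbit means *)

Section means.
Variable R : realType.
Implicit Types (c : R[i]).

Definition mean c N : R[i] := N.+1%:R^-1 * \sum_(j < N.+1) c ^+ j.

Lemma near_div_natr_le (C e : R[i]) : 0 <= C -> 0 < e ->
  \forall N \near \oo, N.+1%:R^-1 * C <= e.
Proof.
move=> /complex_ge0E -> /complex_gt0E[-> e0]; set D := complex.Re C.
have := @cvg_harmonic R => /cvgrPdist_lt /(_ (complex.Re e / (`|D| + 1))).
have D1 : 0 < `|D| + 1 by rewrite ltr_wpDl.
rewrite divr_gt0// => /(_ isT); apply: filterS => N.
rewrite sub0r normrN ger0_norm ?invr_ge0// ltr_pdivlMr// => /ltW ND.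
have -> : (N.+1%:R^-1 : R[i]) = (N.+1%:R^-1)%:C%C by rewrite fmorphV/= rmorph_nat.
rewrite -rmorphM lecR/= (le_trans _ ND)// ler_wpM2l ?invr_ge0//.
by rewrite (le_trans (ler_norm _))// lerDl.
Qed.

Lemma mean1 N : mean 1 N = 1.
Proof.
rewrite /mean (eq_bigr (fun=> 1)) => [|j _]; last by rewrite expr1n.
by rewrite sumr_const card_ord mulVf// pnatr_eq0.
Qed.

(** The geometric sums of [c] stay bounded. *)
Lemma mean_cvg0 c : `|c| = 1 -> c != 1 -> mean c @ \oo --> 0.
Proof.
move=> c1 cn1; have c0 : 0 < `|c - 1| by rewrite normr_gt0 subr_eq0.
apply/cvgrPdist_le => e e0.
have := @near_div_natr_le (`|c - 1|^-1 * 2) e.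
rewrite mulr_ge0 ?invr_ge0// => /(_ isT e0); apply: filterS => N Ne.
rewrite sub0r normrN /mean normrM [X in X * _]ger0_norm ?invr_ge0//.
apply: le_trans Ne; rewrite ler_wpM2l ?invr_ge0// ler_pdivlMl// -normrM -subrX1.
by rewrite (le_trans (ler_normB _ _))// normr1 normrX c1 expr1n.
Qed.

End means.

Section averages.
Variables (R : realType) (A : cstarAlgType R) (rho : A -> A).
Hypotheses (rhoH : star_hom rho) (rho_le : forall a, `|rho a| <= `|a|).
Implicit Types (a b u : A) (c k : R[i]).

(** If [rho] multiplies the component of degree [n] by [z^n], the limit for
    [c = z^(-n)] is this component. *)
Definition avg c N a : A := N.+1%:R^-1 *: \sum_(j < N.+1) c ^+ j *: iter j rho a.

Lemma iter_rho_star_hom j : star_hom (iter j rho).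
Proof.
split=> [c a b|a b|a]; elim: j => //= j ->.
- by rewrite star_homD// star_homZ.
- exact: star_homM.
- exact: star_homV.
Qed.

Lemma iter_rho_hom j k a : rho a = k *: a -> iter j rho a = k ^+ j *: a.
Proof.
move=> ak; elim: j => [|j IH]; first by rewrite scale1r.
by rewrite iterS IH star_homZ// ak scalerA exprSr.
Qed.

Lemma avg_linear c N : linear (avg c N).
Proof.
move=> k a b; rewrite /avg scalerA [k * _]mulrC -scalerA -scalerDr [k *: \sum_(_ < _) _]scaler_sumr -big_split/=.
congr (_ *: _); apply: eq_bigr => j _; have [-> _ _] := iter_rho_star_hom j.
by rewrite scalerDr !scalerA [k * _]mulrC.
Qed.

Lemma avgB c N a b : avg c N (a - b) = avg c N a - avg c N b.
Proof. by rewrite addrC -scaleN1r avg_linear scaleN1r addrC. Qed.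

Lemma avg0 c N : avg c N 0 = 0.
Proof. by have := avgB c N 0 0; rewrite !subrr. Qed.

Lemma avgD c N a b : avg c N (a + b) = avg c N a + avg c N b.
Proof. by have := avg_linear c N 1 a b; rewrite !scale1r. Qed.

Lemma avg_sum c N I (r : seq I) (P : pred I) (F : I -> A) :
  avg c N (\sum_(i <- r | P i) F i) = \sum_(i <- r | P i) avg c N (F i).
Proof. by apply: (big_morph (avg c N)); [exact: avgD | exact: avg0]. Qed.

Lemma avg_norm_le c N a : `|c| <= 1 -> `|avg c N a| <= `|a|.
Proof.
move=> c1; rewrite normrZ ger0_norm ?invr_ge0// ler_pdivrMl ?ltr0n//.
rewrite (le_trans (ler_norm_sum _ _ _))//.
rewrite (le_trans (ler_sum _ (G := fun=> `|a|) _))//.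
  move=> j _; rewrite normrZ normrX (le_trans (ler_piMl _ _)) ?exprn_ile1//.
  by elim: (j : nat) => // i IH; exact: le_trans (rho_le _) IH.
by rewrite sumr_const card_ord mulr_natl.
Qed.

Lemma avg_hom c N k a : rho a = k *: a -> avg c N a = mean (c * k) N *: a.
Proof.
move=> ak; rewrite /avg /mean -scalerA scaler_suml; congr (_ *: _).
by apply: eq_bigr => j _; rewrite (iter_rho_hom _ ak) scalerA exprMn.
Qed.

Lemma avg_mull c N k u a : rho u = k *: u -> avg c N (u ** a) = u ** avg (c * k) N a.
Proof.
move=> uk; rewrite /avg cmulZr cmul_sumr; congr (_ *: _); apply: eq_bigr => j _.
by have [_ -> _] := iter_rho_star_hom j; rewrite (iter_rho_hom _ uk) cmulZl cmulZr scalerA exprMn.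
Qed.

Lemma avg_mulr c N k u a : rho u = k *: u -> avg c N (a ** u) = avg (c * k) N a ** u.
Proof.
move=> uk; rewrite /avg cmulZl cmul_suml; congr (_ *: _); apply: eq_bigr => j _.
by have [_ -> _] := iter_rho_star_hom j; rewrite (iter_rho_hom _ uk) cmulZl cmulZr scalerA exprMn.
Qed.

Lemma star_avg c N a : star (avg c N a) = avg c^* N (star a).
Proof.
rewrite /avg starZ star_sum conj_Creal ?ger0_real ?invr_ge0//; congr (_ *: _).
apply: eq_bigr => j _; rewrite starZ rmorphXn.
by have [_ _ ->] := iter_rho_star_hom j.
Qed.

End averages.

Section fejer_coefficients.
Variable R : realType.

(** The coefficient [1 - `|n| / (M + 1)] of the Fejer kernel for
    [`|n| <= M + 1], as the proportion of the [k <= M] with [0 <= k + n <= M]. *)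
Definition fejer_coef M (n : int) : R[i] :=
  M.+1%:R^-1 * \sum_(k < M.+1) \sum_(l < M.+1) (k%:Z - l%:Z + n == 0)%:R.

Lemma sum_ord_shift_le K p : (\sum_(k < K) (K <= k + p) <= p)%N.
Proof.
rewrite (reindex_inj rev_ord_inj)/=.
apply: (@leq_trans (\sum_(k < K) (k < p))).
  apply: leq_sum => k _; have := ltn_ord k.
  by case: (ltnP k p) => [_ _|pk kK]; [exact: leq_b1 | rewrite leqn0 eqb0 -ltnNge; lia].
elim: K => [|K IH]; first by rewrite big_ord0.
rewrite big_ord_recr/=; case: ltnP => Kp; last by rewrite addn0.
suff h : (\sum_(k < K) (k < p) <= K)%N by rewrite addn1; exact: leq_ltn_trans h Kp.
rewrite -[K in leqRHS]card_ord -sum1_card; apply: leq_sum => k _; exact: leq_b1.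
Qed.

Lemma fejer_coefN M n : fejer_coef M (- n) = fejer_coef M n.
Proof.
rewrite /fejer_coef exchange_big; congr (_ * _).
apply: eq_bigr => k _; apply: eq_bigr => l _.
by rewrite -[in RHS]oppr_eq0 opprD opprB.
Qed.

Lemma fejer_coef_dist M n : `|1 - fejer_coef M n| <= M.+1%:R^-1 * `|n|%N%:R.
Proof.
suff pos p : `|1 - fejer_coef M p%:Z| <= M.+1%:R^-1 * p%:R.
  case: n => n; first exact: pos.
  by rewrite NegzE fejer_coefN; exact: pos.
have -> : 1 - fejer_coef M p%:Z = M.+1%:R^-1 * (\sum_(k < M.+1) (M.+1 <= k + p))%N%:R.
  rewrite natr_sum /fejer_coef -[X in X - _](mulVf (x := M.+1%:R)) ?pnatr_eq0//.
  rewrite -mulrBr; congr (_ * _).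
  rewrite -[X in X%:R - _]card_ord -sum1_card natr_sum -sumrB; apply: eq_bigr => k _.
  have lE (l : 'I_M.+1) : (k%:Z - l%:Z + p%:Z == 0) = (k + p == l)%N.
    by rewrite addrAC subr_eq0 -PoszD.
  under eq_bigr do rewrite lE.
  have [kp|kp] := ltnP (k + p) M.+1.
    rewrite (bigD1 (Ordinal kp))//= eqxx big1 ?addr0 ?subrr// => l lk.
    by case: eqP => // kl; case/eqP: lk; apply: val_inj.
  by rewrite big1 ?subr0// => l _; case: eqP => // kl; have := ltn_ord l; lia.
rewrite ger0_norm; first by rewrite ler_wpM2l ?invr_ge0// ler_nat sum_ord_shift_le.
by rewrite mulr_ge0 ?invr_ge0.
Qed.

End fejer_coefficients.

Section orbit_means.
Variables (R : realType) (X : topologicalType) (cptX : compact [set: X]).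
Variables (alpha : homeomorphism X) (x0 : X).
Notation CX := (contC R cptX).
Implicit Types f g h : CX.

(** These means take the place of the integral against an invariant measure:
    they are invariant in the limit [N --> oo]. *)
Definition orbit_mean N f : R[i] := N.+1%:R^-1 * \sum_(j < N.+1) f (iter j alpha x0).

Lemma orbit_meanD N f g : orbit_mean N (f + g) = orbit_mean N f + orbit_mean N g.
Proof. by rewrite /orbit_mean -mulrDr -big_split. Qed.

Lemma orbit_meanZ N c f : orbit_mean N (c *: f) = c * orbit_mean N f.
Proof. by rewrite /orbit_mean mulrCA; congr (_ * _); rewrite mulr_sumr. Qed.

Lemma orbit_mean0 N : orbit_mean N 0 = 0.
Proof. by have := orbit_meanZ N 0 0; rewrite scale0r mul0r. Qed.

Lemma orbit_meanB N f g : orbit_mean N (f - g) = orbit_mean N f - orbit_mean N g.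
Proof. by rewrite orbit_meanD -scaleN1r orbit_meanZ mulN1r. Qed.

Lemma orbit_mean_sum N I (r : seq I) (P : pred I) (F : I -> CX) :
  orbit_mean N (\sum_(i <- r | P i) F i) = \sum_(i <- r | P i) orbit_mean N (F i).
Proof. by apply: (big_morph (orbit_mean N)); [exact: orbit_meanD | exact: orbit_mean0]. Qed.

Lemma orbit_mean_star N f : orbit_mean N (star f) = (orbit_mean N f)^*.
Proof.
rewrite /orbit_mean rmorphM rmorph_sum/=; congr (_ * _).
by rewrite conj_Creal// ger0_real// invr_ge0.
Qed.

Lemma orbit_mean_norm_le N f : `|orbit_mean N f| <= `|f|.
Proof.
rewrite normrM ger0_norm ?invr_ge0// ler_pdivrMl ?ltr0n//.
rewrite (le_trans (ler_norm_sum _ _ _))//.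
rewrite (le_trans (ler_sum _ (G := fun=> `|f|) _))//.
  by move=> j _; exact: contC_norm_ub.
by rewrite sumr_const card_ord mulr_natl.
Qed.

Lemma orbit_mean_le N f g : (forall x, f x <= g x) -> orbit_mean N f <= orbit_mean N g.
Proof. by move=> fg; rewrite ler_wpM2l ?invr_ge0// ler_sum. Qed.

Lemma orbit_mean_shift_cvg f :
  (fun N => orbit_mean N (f - compC alpha f)) @ \oo --> (0 : R[i]).
Proof.
apply/cvgrPdist_le => e e0.
have := @near_div_natr_le R (2 * `|f|) e.
rewrite mulr_ge0// => /(_ isT e0); apply: filterS => N Ne.
rewrite sub0r normrN orbit_meanB -mulrBr -sumrB.
have -> : \sum_(j < N.+1) (f (iter j alpha x0) - compC alpha f (iter j alpha x0)) =
    f x0 - f (iter N.+1 alpha x0).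
  by elim: (N.+1) => [|n IH]; [rewrite big_ord0 subrr | rewrite big_ord_recr/= IH addrA subrK].
rewrite normrM ger0_norm ?invr_ge0// (le_trans _ Ne)// ler_wpM2l ?invr_ge0//.
rewrite (le_trans (ler_normB _ _))// mulr_natl mulr2n.
by rewrite lerD ?contC_norm_ub.
Qed.

(** A function that is positive somewhere has a finite sum of translates that
    is bounded below by a positive constant, by minimality; the orbit means of
    all translates have the same limits. *)
Lemma orbit_mean_faithful f : minimal_map alpha -> (forall x, 0 <= f x) ->
  orbit_mean ^~ f @ \oo --> (0 : R[i]) -> f = 0.
Proof.
move=> amin f_ge0 fm; apply: contrapT => /eqP f0.
have [s sP] := minimal_finite_cover amin f0.
pose F k := iter k (compC alpha) f.
have FE k x : F k x = f (iter k alpha x) by exact: iter_compCE.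
have Fm k : orbit_mean ^~ (F k) @ \oo --> (0 : R[i]).
  elim: k => // k IH.
  have -> : orbit_mean ^~ (F k.+1) =
      (fun N => orbit_mean N (F k) - orbit_mean N (F k - compC alpha (F k))).
    by apply/funext => N; rewrite -orbit_meanB opprB addrC subrK.
  rewrite -(subr0 (0 : R[i])); apply: cvgB => //; exact: orbit_mean_shift_cvg.
pose G : CX := \sum_(k <- s) F k.
have F0 k x : 0 <= F k x by rewrite FE.
have G0 x : 0 < G x.
  rewrite contC_sumE lt_def sumr_ge0// andbT psumr_neq0//.
  by apply: sub_has (sP x) => k; rewrite lt_def FE f_ge0 andbT.
have Gm : orbit_mean ^~ G @ \oo --> (0 : R[i]).
  under eq_cvg do rewrite orbit_mean_sum.
  have {2}-> : (0 : R[i]) = \sum_(k <- s) 0 by rewrite big1.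
  exact: (@cvg_sumr R R[i]).
have [x|q qE] := @contC_inverse R X cptX G; first by rewrite gt_eqF.
have le1 N : 1 <= `|q| * orbit_mean N G.
  rewrite -orbit_meanZ.
  have -> : 1 = orbit_mean N (constC cptX 1).
    by rewrite /orbit_mean/= sumr_const card_ord mulVf// pnatr_eq0.
  apply: orbit_mean_le => x; rewrite contCZE -[constC cptX 1 x]/(1 : R[i]).
  have q0 : 0 < q x by rewrite qE invr_gt0.
  rewrite -(mulVf (x := G x)) ?gt_eqF// -qE ler_wpM2r ?(ltW (G0 x))//.
  by rewrite -[leLHS]ger0_norm ?(ltW q0)// contC_norm_ub.
have q1 : 0 < (`|q| + 1)^-1 / 2 by rewrite divr_gt0 ?invr_gt0 ?ltr_wpDl.
have /cvgrPdist_le/(_ _ q1)/filter_ex[N] := Gm.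
rewrite sub0r normrN => NG.
have : 1 <= `|q| * `|orbit_mean N G|.
  by rewrite -[`|q|]normr_id -normrM ger0_norm// (le_trans ler01 (le1 N)).
rewrite lt_geF// (le_lt_trans (ler_wpM2l _ NG))// mulrA ltr_pdivrMr// mul1r.
apply: (@le_lt_trans _ _ 1); last by rewrite ltr1n.
by rewrite ler_pdivrMr ?ltr_wpDl// mul1r lerDl.
Qed.

End orbit_means.

(** * The conditional expectation and the asymptotic trace *)

(** In this section [T] is to be the range of [tau], [t] the image of a frame of
    the line bundle, and [rho] the endomorphism of [O] that fixes [pi] and
    multiplies [tau] by [z]. *)
Section expectation.
Variables (R : realType) (X : topologicalType) (cptX : compact [set: X]).
Variable alpha : homeomorphism X.
Notation CX := (contC R cptX).
Notation "1_X" := (constC cptX 1).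
Variables (O : cstarAlgType R) (pi : CX -> O) (T : set O).
Hypotheses (piH : star_hom pi) (pi1 : is_identity (pi 1_X))
  (pi_isometry : forall f, `|pi f| = `|f|).
Hypotheses (T_lact : forall f u, T u -> pi f ** u = u ** pi (compC alpha f))
  (T_mull : forall f u, T u -> T (pi f ** u))
  (T_mulr : forall u f, T u -> T (u ** pi f))
  (T_ip : forall u v, T u -> T v -> range pi (star u ** v))
  (T_theta : forall u v, T u -> T v -> range pi (u ** star v))
  (gen : generates (range pi `|` T)).
Variable t : seq O.
Hypotheses (tT : forall u, u \in t -> T u)
  (t_coisometry : \sum_(u <- t) u ** star u = pi 1_X)
  (t_isometry : \sum_(u <- t) star u ** u = pi 1_X).
Variables (rho : O -> O) (z : R[i]).
Hypotheses (rhoH : star_hom rho) (rho_pi : forall f, rho (pi f) = pi f)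
  (rho_T : forall u, T u -> rho u = z *: u).
Hypotheses (z_norm : `|z| = 1) (z_free : forall m : int, z ^ m = 1 -> m = 0).

Lemma rho_le a : `|rho a| <= `|a|.
Proof. exact: (star_hom_norm_le pi1 a rhoH). Qed.

Lemma z_neq0 : z != 0.
Proof. by rewrite -normr_eq0 z_norm oner_eq0. Qed.

Lemma norm_zX (m : int) : `|z ^ m| = 1.
Proof. by case: m => n; rewrite /exprz ?normfV normrX z_norm expr1n ?invr1. Qed.

Lemma conj_zX (m : int) : (z ^ m)^* = z ^ (- m).
Proof.
have zc : z^* = z^-1.
  apply: (mulfI z_neq0); rewrite mulfV ?z_neq0//.
  by rewrite -normCK z_norm expr1n.
by rewrite rmorphXz ?unitfE ?z_neq0//= zc exprz_inv.
Qed.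

Definition homogeneous (m : int) (a : O) := rho a = z ^ m *: a.

Lemma homogeneous_pi f : homogeneous 0 (pi f).
Proof. by rewrite /homogeneous expr0z scale1r. Qed.

Lemma homogeneous_T u : T u -> homogeneous 1 u.
Proof. by rewrite /homogeneous expr1z; exact: rho_T. Qed.

Lemma homogeneous_star m a : homogeneous m a -> homogeneous (- m) (star a).
Proof. by rewrite /homogeneous star_homV// => ->; rewrite starZ conj_zX. Qed.

Lemma homogeneous_mul m n a b :
  homogeneous m a -> homogeneous n b -> homogeneous (m + n) (a ** b).
Proof.
rewrite /homogeneous star_homM// => -> ->.
by rewrite cmulZl cmulZr scalerA expfzDr ?z_neq0.
Qed.

Lemma homogeneous_word n b : word T (range pi) n b -> homogeneous n b.
Proof.
elim=> [_ [f _ <-]|m u a Tu _ am]; first exact: homogeneous_pi.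
by rewrite -add1n PoszD; apply: homogeneous_mul => //; exact: homogeneous_T.
Qed.

Lemma homogeneous_wordV n b :
  word [set star u | u in T] (range pi) n b -> homogeneous (- n%:Z) b.
Proof.
elim=> [_ [f _ <-]|m _ a [u Tu <-] _ am]; first exact: homogeneous_pi.
rewrite -add1n PoszD opprD; apply: homogeneous_mul => //.
exact: homogeneous_star (homogeneous_T Tu).
Qed.

Lemma span_words (S : set O) : closed_subspace S ->
  (forall m b, homogeneous m b -> (m = 0 -> range pi b) -> S b) -> S = setT.
Proof.
move=> HS Sw; apply: (words_total _ _ _ _ _ _ pi1 _ gen HS) => //.
- by move=> _ _ [f _ <-] [g _ <-]; exists (f ** g) => //; rewrite star_homM.
- by move=> _ [f _ <-]; exists (star f) => //; rewrite star_homV.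
- by move=> _ u [f _ <-]; exact: T_mull.
- by move=> u _ Tu [f _ <-]; exact: T_mulr.
- move=> n b bw; apply: Sw (homogeneous_word bw) _.
  by case: bw => // m u a _ _ /eqP.
- move=> n b bw; apply: Sw (homogeneous_wordV bw) _.
  by case: bw => // m u a _ _ /eqP.
Qed.

Lemma mean_zX_cvg0 (m : int) : m != 0 -> mean (z ^ m) @ \oo --> 0.
Proof. by move=> m0; apply: mean_cvg0; [exact: norm_zX | apply: contra_neq m0; exact: z_free]. Qed.

Lemma avg_zX (m n : int) N a : homogeneous n a ->
  avg rho (z ^ m) N a = mean (z ^ (m + n)) N *: a.
Proof. by move=> an; rewrite (avg_hom _ _ _ an)// expfzDr ?z_neq0. Qed.

Lemma avg_hom_cvg (m n : int) a (an : homogeneous n a) :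
  (fun N => avg rho (z ^ m) N a) @ \oo --> (m + n == 0)%:R *: a.
Proof.
under eq_cvg do rewrite (avg_zX _ _ an).
apply: cvgZl; have [->|mn] := eqVneq (m + n) 0; last exact: mean_zX_cvg0.
by under eq_cvg do rewrite expr0z mean1; exact: cvg_cst.
Qed.

(** The means are constant in degree zero and tend to zero in every other
    degree. The elements with a limit in the range of [pi] form a closed
    subspace because [pi] is isometric, and the words span a dense one. *)
Lemma expectation_exists a : exists f : CX, avg rho 1 ^~ a @ \oo --> pi f.
Proof.
pose S := [set a : O | exists f : CX, avg rho 1 ^~ a @ \oo --> pi f].
suff ST : S = setT by have : S a by rewrite ST.
apply: span_words => [|m b bm m0]; last first.
  have [mE|mn] := eqVneq m 0.
    have [f _ fb] := m0 mE; exists f; rewrite fb.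
    by have := avg_hom_cvg (m := 0) bm; rewrite expr0z add0r mE eqxx scale1r.
  exists 0; rewrite (star_hom0 piH).
  by have := avg_hom_cvg (m := 0) bm; rewrite expr0z add0r (negPf mn) scale0r.
split=> [||c x y [f xf] [g yg]].
- apply/closed_approx => x xS.
  have n1 : `|1 : R[i]| <= 1 by rewrite normr1.
  pose h : R[i] := 2^-1.
  have h0 n : 0 < h ^+ n by rewrite exprn_gt0// invr_gt0.
  have h1 : h < 1 by rewrite invf_lt1// ltr1n.
  (* Approximants at distance [2^-n], so that their expectations converge. *)
  have /choice[b bP] (n : nat) : exists b : O * CX,
      `|x - b.1| <= h ^+ n /\ avg rho 1 ^~ b.1 @ \oo --> pi b.2.
    by have [b [f bf] xb] := xS _ (h0 n); exists (b, f).
  pose f n := (b n).2.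
  have f_le n : `|f n.+1 - f n| <= 2 * h ^+ n.
    rewrite -pi_isometry (star_homB piH).
    apply: (cvg_norm_le (u := fun N => avg rho 1 N ((b n.+1).1 - (b n).1))).
      under eq_cvg do rewrite avgB//.
      by apply: cvgB; [exact: (bP n.+1).2 | exact: (bP n).2].
    apply: nearW => N; rewrite (le_trans (avg_norm_le rho_le _ _ n1))//.
    have -> : (b n.+1).1 - (b n).1 = (x - (b n).1) - (x - (b n.+1).1).
      by rewrite opprB [RHS]addrC addrA subrK.
    rewrite (le_trans (ler_normB _ _))// mulr_natl mulr2n lerD ?(bP n).1//.
    by rewrite (le_trans (bP n.+1).1)// exprS ler_piMl ?(ltW (h0 n)) ?(ltW h1).
  have [g fg] := geometric_cvg (ltW (h0 1%N)) h1 (ler0n R[i] 2) f_le.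
  exists g; apply/cvgrPdist_le => e e0.
  have e3 : 0 < e / 3 by rewrite divr_gt0.
  have [n [fn hn]] : exists n, `|g - f n| <= e / 3 /\ h ^+ n <= e / 3.
    move/cvgrPdist_le : fg => /(_ _ e3) fg.
    have := near_expr_lt (ltW (h0 1%N)) h1 e3.
    by move=> /(filterI fg)/filter_ex[n [? /ltW ?]]; exists n.
  have [/cvgrPdist_le /(_ _ e3) bn xn] := ((bP n).2, (bP n).1).
  apply: filterS bn => N bN.
  have -> : pi g - avg rho 1 N x = pi (g - f n) + (pi (f n) - avg rho 1 N (b n).1) -
      avg rho 1 N (x - (b n).1).
    by rewrite (star_homB piH) (avgB rhoH) opprB !addrA !subrK.
  have -> : e = e / 3 + e / 3 + e / 3 by field.
  rewrite (le_trans (ler_normB _ _))// lerD//; last first.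
    by rewrite (le_trans (avg_norm_le rho_le _ _ n1))// (le_trans xn).
  by rewrite (le_trans (ler_normD _ _))// lerD// pi_isometry.
- by exists 0; rewrite (star_hom0 piH); under eq_cvg do rewrite avg0//; exact: cvg_cst.
- exists (c *: f + g); rewrite (star_homD piH) (star_homZ piH).
  under eq_cvg do rewrite avg_linear//.
  by apply: cvgD => //; exact: cvgZr.
Qed.

Definition expectation (a : O) : CX := sval (cid (expectation_exists a)).
Notation E := expectation.

Lemma expectation_cvg a : avg rho 1 ^~ a @ \oo --> pi (E a).
Proof. by rewrite /expectation; case: cid. Qed.

Lemma expectation_unique a f : avg rho 1 ^~ a @ \oo --> pi f -> E a = f.
Proof.
move=> af; have ab := cvg_eq (@expectation_cvg a) af (fun=> erefl).
apply/eqP; rewrite -subr_eq0 -normr_eq0 -pi_isometry (star_homB piH) ab subrr.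
by rewrite normr0.
Qed.

Lemma expectation_linear : linear E.
Proof.
move=> c a b; apply: expectation_unique; under eq_cvg do rewrite (avg_linear rhoH).
by rewrite (star_homD piH) (star_homZ piH); apply: cvgD; [apply: cvgZr|]; exact: expectation_cvg.
Qed.

Lemma expectationB a b : E (a - b) = E a - E b.
Proof. by rewrite addrC -scaleN1r expectation_linear scaleN1r addrC. Qed.

Lemma expectation0 : E 0 = 0.
Proof. by have := expectationB 0 0; rewrite !subrr. Qed.

Lemma expectationD a b : E (a + b) = E a + E b.
Proof. by have := expectation_linear 1 a b; rewrite !scale1r. Qed.

Lemma expectationZ c a : E (c *: a) = c *: E a.
Proof. by have := expectation_linear c a 0; rewrite expectation0 !addr0. Qed.

Lemma expectation_sum I (r : seq I) (P : pred I) (F : I -> O) :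
  E (\sum_(i <- r | P i) F i) = \sum_(i <- r | P i) E (F i).
Proof. by apply: (big_morph E); [exact: expectationD | exact: expectation0]. Qed.

Lemma expectation_norm_le a : `|E a| <= `|a|.
Proof.
rewrite -pi_isometry; apply: cvg_norm_le (@expectation_cvg a) _.
by apply: nearW => N; apply: (avg_norm_le rho_le); rewrite normr1.
Qed.

Lemma expectation_star a : E (star a) = star (E a).
Proof.
apply: expectation_unique; rewrite (star_homV piH).
have -> : avg rho 1 ^~ (star a) = (fun N => star (avg rho 1 N a)).
  by apply/funext => N; rewrite (star_avg rhoH) rmorph1.
exact: cvg_star (@expectation_cvg a).
Qed.

Lemma expectation_pi f : E (pi f) = f.
Proof.
apply: expectation_unique; have := avg_hom_cvg (m := 0) (homogeneous_pi f).
by rewrite expr0z scale1r.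
Qed.

Lemma expectation_homogeneous (m : int) a : homogeneous m a -> m != 0 -> E a = 0.
Proof.
move=> am m0; apply: expectation_unique; rewrite (star_hom0 piH).
by have := avg_hom_cvg (m := 0) am; rewrite expr0z add0r (negPf m0) scale0r.
Qed.

Lemma expectation_pi_mul f a : E (pi f ** a) = f ** E a.
Proof.
apply: expectation_unique; rewrite (star_homM piH).
have -> : avg rho 1 ^~ (pi f ** a) = (fun N => pi f ** avg rho 1 N a).
  by apply/funext => N; rewrite (avg_mull rhoH _ _ (k := 1)) ?mulr1// rho_pi scale1r.
exact: (cvg_cmul (f := fun=> pi f) (cvg_cst _) (@expectation_cvg a)).
Qed.

Lemma expectation_mul_pi f a : E (a ** pi f) = f ** E a.
Proof.
rewrite -[a]starK -[pi f]starK -starM expectation_star -(star_homV piH) expectation_pi_mul starM.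
by rewrite -expectation_star !starK; apply: contC_eqP => x; exact: mulrC.
Qed.

Lemma homogeneous0_pi a : homogeneous 0 a -> exists f, a = pi f.
Proof.
move=> a0; exists (E a); have := avg_hom_cvg (m := 0) a0.
by rewrite expr0z scale1r => al; exact: cvg_eq al (@expectation_cvg a) (fun=> erefl).
Qed.

Lemma frame_conj_pi f : \sum_(u <- t) star u ** pi f ** u = pi (compC alpha f).
Proof.
rewrite -[RHS](pi1 _).1 -t_isometry cmul_suml big_seq [RHS]big_seq.
by apply: eq_bigr => u /tT Tu; rewrite -!cmulA T_lact.
Qed.

Lemma expectation_frame_conj a : E (\sum_(u <- t) star u ** a ** u) = compC alpha (E a).
Proof.
apply: expectation_unique; rewrite -frame_conj_pi.
have -> : avg rho 1 ^~ (\sum_(u <- t) star u ** a ** u) =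
    (fun N => \sum_(u <- t) star u ** avg rho 1 N a ** u).
  apply/funext => N; rewrite (avg_sum rhoH) big_seq [RHS]big_seq.
  apply: eq_bigr => u /tT Tu.
  rewrite -cmulA (avg_mull rhoH _ _ (k := z ^ (-1))); last first.
    exact: homogeneous_star (homogeneous_T Tu).
  rewrite (avg_mulr rhoH _ _ (k := z)); last exact: rho_T.
  by rewrite mul1r exprN1 mulVf ?z_neq0// cmulA.
apply: (@cvg_sumr R O) => u; apply: cvg_cmul; last exact: cvg_cst.
by apply: cvg_cmul; [exact: cvg_cst | exact: expectation_cvg].
Qed.

Lemma expectation_pi_comm f a : E (pi f ** a) = E (a ** pi f).
Proof. by rewrite expectation_pi_mul expectation_mul_pi. Qed.

(** The expectation is a trace up to the homeomorphism: conjugation by the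
    frame, [b |-> \sum_v v^* b v], corresponds to [f |-> f o alpha] under the
    expectation, and [v^* u] is a function, which may be moved to the right. *)
Lemma expectation_T_comm u b : T u -> compC alpha (E (u ** b)) = E (b ** u).
Proof.
move=> Tu; rewrite -expectation_frame_conj -[u in RHS](pi1 _).1 -t_coisometry.
rewrite cmul_suml cmul_sumr !expectation_sum big_seq [RHS]big_seq.
apply: eq_bigr => v /tT Tv; have [g _ gE] := T_ip Tv Tu.
by rewrite [star v ** _]cmulA -gE -cmulA expectation_pi_comm -!cmulA -gE.
Qed.

Lemma square_homogeneous0 f : exists2 g : CX, (forall x, 0 <= g x) & star (pi f) ** pi f = pi g.
Proof.
exists (star f ** f); last by rewrite (star_homM piH) (star_homV piH).
by move=> x; rewrite contC_mulE contC_starE -normCKC exprn_ge0.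
Qed.

(** Insertion of the frame turns [d^* d] into a sum of squares of homogeneous
    elements of smaller degree. *)
Lemma square_homogeneous_reduce (P : O -> Prop) (F : O -> O) d :
  \sum_(u <- t) star (F u) ** F u = pi 1_X ->
  (forall u, u \in t -> P (F u ** d)) ->
  (forall b, P b -> exists2 g : CX, (forall x, 0 <= g x) & star b ** b = pi g) ->
  exists2 g : CX, (forall x, 0 <= g x) & star d ** d = pi g.
Proof.
move=> F1 PF Psq.
have -> : star d ** d = \sum_(u <- t) star (F u ** d) ** (F u ** d).
  rewrite -{2}[d](pi1 d).1 -F1 cmul_suml cmul_sumr.
  by apply: eq_bigr => u _; rewrite starM !cmulA.
rewrite big_seq; apply: (big_ind (fun b => exists2 g : CX, (forall x, 0 <= g x) & b = pi g)).
- by exists 0 => [x|]; [rewrite contC0E lexx | rewrite (star_hom0 piH)].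
- move=> _ _ [f f0 ->] [g g0 ->]; exists (f + g); last by rewrite (star_homD piH).
  by move=> x; rewrite contCDE addr_ge0.
- by move=> u ut; apply: Psq; exact: PF.
Qed.

Lemma square_homogeneous (m : int) d : homogeneous m d ->
  exists2 g : CX, (forall x, 0 <= g x) & star d ** d = pi g.
Proof.
have hT u : u \in t -> homogeneous 1 u by move=> /tT; exact: homogeneous_T.
have pos n b : homogeneous n%:Z b ->
    exists2 g : CX, (forall x, 0 <= g x) & star b ** b = pi g.
  elim: n b => [b /homogeneous0_pi[f ->]|n IH b bn]; first exact: square_homogeneous0.
  apply: (@square_homogeneous_reduce (homogeneous n%:Z) (fun u => star u)) => //.
    by under eq_bigr do rewrite starK.
  move=> u /hT/homogeneous_star u1; have := homogeneous_mul u1 bn.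
  by rewrite -add1n PoszD addKr.
have neg n b : homogeneous (- n%:Z) b ->
    exists2 g : CX, (forall x, 0 <= g x) & star b ** b = pi g.
  elim: n b => [b /homogeneous0_pi[f ->]|n IH b bn]; first exact: square_homogeneous0.
  apply: (@square_homogeneous_reduce (homogeneous (- n%:Z)) id) => //.
  move=> u /hT u1; have := homogeneous_mul u1 bn.
  by rewrite -add1n PoszD opprD addNKr.
by case: m => n; [exact: pos | rewrite NegzE; exact: neg].
Qed.

(** The components of a finite sum of homogeneous elements are collected by
    degree, so that cross terms of different degrees can be told apart. *)
Lemma graded_approx a e : 0 < e -> exists s : seq int, exists d : int -> O,
  [/\ uniq s, (forall m, homogeneous m (d m)) & `|a - \sum_(m <- s) d m| <= e].
Proof.
pose graded b := exists2 s : seq (int * O),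
  (forall p, p \in s -> homogeneous p.1 p.2) & b = \sum_(p <- s) p.2.
have homogeneous_sum m (I : eqType) (r : seq I) (P : pred I) (F : I -> O) :
    (forall i, i \in r -> P i -> homogeneous m (F i)) -> homogeneous m (\sum_(i <- r | P i) F i).
  move=> Fm; rewrite /homogeneous (star_hom_sum rhoH) scaler_sumr big_seq_cond [RHS]big_seq_cond.
  by apply: eq_bigr => i /andP[]; exact: Fm.
pose S := [set b | forall e, 0 < e -> exists2 b', graded b' & `|b - b'| <= e].
move: e; suff ST : S = setT.
  have aS : S a by rewrite ST.
  move=> e /aS[_ [s sP ->] ae]; exists (undup (map fst s)), (fun m => \sum_(p <- s | p.1 == m) p.2).
  split; first exact: undup_uniq.
    by move=> m; apply: homogeneous_sum => p /sP ph /eqP <-.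
  suff -> : \sum_(m <- undup [seq p.1 | p <- s]) \sum_(p <- s | p.1 == m) p.2 = \sum_(p <- s) p.2 by [].
  rewrite (exchange_big_dep xpredT)//= big_seq [RHS]big_seq; apply: eq_bigr => p ps.
  have pE : [seq m <- undup [seq q.1 | q <- s] | p.1 == m] = [:: p.1].
    rewrite (eq_filter (a2 := pred1 p.1)) => [|m]; last exact: eq_sym.
    by rewrite filter_pred1_uniq ?undup_uniq// mem_undup map_f.
  by rewrite -big_filter pE big_seq1.
have grS b : graded b -> S b by move=> bg e e0; exists b; rewrite ?subrr ?normr0 ?ltW.
apply: span_words => [|m b bm _]; last first.
  by apply: grS; exists [:: (m, b)]; rewrite ?big_seq1// => p; rewrite inE => /eqP ->.
split.
- apply/closed_approx => b bS e e0; have e2 : 0 < e / 2 by rewrite divr_gt0.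
  have [c cS bc] := bS _ e2; have [d dg cd] := cS _ e2; exists d => //.
  rewrite (splitr e) -[b](subrK c) -addrA (le_trans (ler_normD _ _))// lerD//.
- by apply: grS; exists [::]; rewrite ?big_nil.
- move=> k b c bS cS e e0.
  have e2 : 0 < e / 2 by rewrite divr_gt0.
  have k1 : 0 < `|k| + 1 by rewrite ltr_wpDl.
  have [|_ [s sP ->] bs] := bS (e / 2 / (`|k| + 1)); first by rewrite divr_gt0.
  have [_ [s' s'P ->] cs] := cS _ e2.
  exists (k *: (\sum_(p <- s) p.2) + \sum_(p <- s') p.2).
    exists ([seq (p.1, k *: p.2) | p <- s] ++ s'); last first.
      by rewrite big_cat big_map/= scaler_sumr.
    move=> p; rewrite mem_cat => /orP[/mapP[q /sP qh ->]/=|]; last exact: s'P.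
    by rewrite /homogeneous (star_homZ rhoH) qh !scalerA mulrC.
  rewrite opprD addrACA -scalerBr (splitr e) (le_trans (ler_normD _ _))// lerD//.
  rewrite normrZ (le_trans (ler_wpM2l _ bs))// mulrCA ler_piMr ?(ltW e2)//.
  by rewrite ler_pdivrMr// mul1r lerDl.
Qed.

(** For a finite sum of homogeneous elements the expectation kills the cross
    terms and leaves the sum of the squares [d_m^* d_m]. *)
Lemma expectation_square_ge0 a x : 0 <= E (star a ** a) x.
Proof.
apply: complex_ge0_closed => e e0.
have M0 : 0 < `|a| *+ 2 + 1 by rewrite ltr_wpDl ?mulrn_wge0.
(* The bound [h <= 1] gives [`|b| <= `|a| + 1] below. *)
pose h : R[i] := Num.min 1 (e / (`|a| *+ 2 + 1)).
have [h0 h1 he] : [/\ 0 < h, h <= 1 & h * (`|a| *+ 2 + 1) <= e].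
  have q0 : 0 < e / (`|a| *+ 2 + 1) by rewrite divr_gt0.
  rewrite /h -ler_pdivlMr//; have /orP[le|le] : (1 <= e / (`|a| *+ 2 + 1)) || (e / (`|a| *+ 2 + 1) <= 1).
    by apply: real_comparable; rewrite ger0_real ?ltW.
  - by rewrite min_l.
  - by rewrite min_r.
have [s [d [su dh]]] := graded_approx a h0.
set b := \sum_(m <- s) d m => ab.
exists (E (star b ** b) x).
  have -> : E (star b ** b) = \sum_(m <- s) E (star (d m) ** d m).
    rewrite /b star_sum cmul_suml expectation_sum; apply: eq_big_seq => m ms.
    rewrite cmul_sumr expectation_sum (bigD1_seq m)//= big1 ?addr0// => n nm.
    apply: expectation_homogeneous (homogeneous_mul (homogeneous_star (dh m)) (dh n)) _.
    by rewrite addrC subr_eq0.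
  rewrite contC_sumE sumr_ge0// => m _.
  by have [g g0 ->] := square_homogeneous (dh m); rewrite expectation_pi.
rewrite -contCBE -expectationB (le_trans (contC_norm_ub _ _))// (le_trans (expectation_norm_le _))//.
apply: le_trans he.
have -> : star a ** a - star b ** b = star a ** (a - b) + star (a - b) ** b.
  by rewrite cmulBr starB cmulBl addrA subrK.
have bM : `|b| <= `|a| + 1.
  rewrite -[b](subrK a) addrC (le_trans (ler_normD _ _))// lerD2l distrC.
  exact: le_trans ab h1.
rewrite (le_trans (ler_normD _ _))// mulr2n -addrA mulrDr lerD//.
  by rewrite (le_trans (norm_cmul_le _ _))// norm_star mulrC ler_pM.
by rewrite (le_trans (norm_cmul_le _ _))// norm_star ler_pM.
Qed.

(** The degenerate case of the Cauchy-Schwarz inequality, at each point of [X]. *)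
Lemma expectation_square_eq0 a : E (star a ** a) = 0 -> forall c, E (c ** a) = 0.
Proof.
move=> a0 c; apply: contC_eqP => x; apply: contrapT => /eqP q0.
set q := E (c ** a) x in q0; set C := E (c ** star c) x.
have C0 : 0 <= C by have := expectation_square_ge0 (star c) x; rewrite starK.
have C1 : 0 < C + 1 by rewrite ltr_wpDl.
(* This makes the part of first order in [l] exceed the quadratic one. *)
pose l : R[i] := - q / (C + 1).
have := expectation_square_ge0 (l *: star c + a) x.
have -> : star (l *: star c + a) ** (l *: star c + a) =
    (l^* * l) *: (c ** star c) + l^* *: (c ** a) + l *: star (c ** a) + star a ** a.
  rewrite starD starZ starK starM cmulDl !cmulDr !cmulZl !cmulZr scalerA.
  by rewrite addrA.
rewrite !expectationD !expectationZ a0 addr0 expectation_star !contCDE !contCZE contC_starE -/q -/C.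
have -> : l^* * l * C + l^* * q + l * q^* = - (`|q| ^+ 2 * (C + 2) / (C + 1) ^+ 2).
  have Cc : (C + 1)^* = C + 1 by rewrite conj_Creal// ger0_real// ltW.
  rewrite normCK /l fmorph_div/= rmorphN Cc; field; exact: lt0r_neq0.
rewrite oppr_ge0 lt_geF//.
by rewrite divr_gt0 ?exprn_gt0// mulr_gt0 ?exprn_gt0 ?normr_gt0// ltr_wpDl.
Qed.

(** Since [`|\sum_(k <= M) z ^ (k j)|^2 >= 0], the operator below, which
    integrates the gauge automorphisms against the Fejer kernel of degree [M],
    is almost contractive for large [N]. *)
Definition fejer M N (a : O) : O :=
  M.+1%:R^-1 *: \sum_(k < M.+1) \sum_(l < M.+1) avg rho (z ^ (k%:Z - l%:Z)) N a.

Lemma fejer_cvg_homogeneous M (n : int) a : homogeneous n a ->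
  fejer M ^~ a @ \oo --> fejer_coef R M n *: a.
Proof.
move=> an; rewrite -scalerA; apply: cvgZr; rewrite scaler_suml.
apply: cvg_sumr => k; rewrite scaler_suml; apply: cvg_sumr => l.
exact: avg_hom_cvg.
Qed.

Lemma fejer_sum M N (s : seq int) (d : int -> O) :
  fejer M N (\sum_(m <- s) d m) = \sum_(m <- s) fejer M N (d m).
Proof.
rewrite /fejer -scaler_sumr; congr (_ *: _).
under eq_bigr do under eq_bigr do rewrite (avg_sum rhoH).
under eq_bigr do rewrite exchange_big.
by rewrite exchange_big.
Qed.

Lemma fejerB M N a b : fejer M N (a - b) = fejer M N a - fejer M N b.
Proof.
rewrite /fejer -scalerBr -sumrB; congr (_ *: _); apply: eq_bigr => k _.
by rewrite -sumrB; apply: eq_bigr => l _; rewrite (avgB rhoH).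
Qed.

Lemma fejer_norm_le M a : \forall N \near \oo, `|fejer M N a| <= 2 * `|a|.
Proof.
pose F j : R[i] := `|\sum_(k < M.+1) (z ^ k%:Z) ^+ j| ^+ 2.
pose w N : R[i] := M.+1%:R^-1 * \sum_(k < M.+1) \sum_(l < M.+1) mean (z ^ (k%:Z - l%:Z)) N.
have FE j : F j = \sum_(k < M.+1) \sum_(l < M.+1) (z ^ (k%:Z - l%:Z)) ^+ j.
  rewrite /F normCK rmorph_sum/= mulr_suml; apply: eq_bigr => k _.
  rewrite mulr_sumr; apply: eq_bigr => l _.
  by rewrite rmorphXn/= conj_zX -exprMn -expfzDr ?z_neq0.
have wE N : w N = M.+1%:R^-1 * (N.+1%:R^-1 * \sum_(j < N.+1) F j).
  congr (_ * _); rewrite /mean; under eq_bigr do rewrite -mulr_sumr.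
  rewrite -mulr_sumr; congr (_ * _); under eq_bigr do rewrite exchange_big.
  by rewrite exchange_big; apply: eq_bigr => j _; rewrite FE.
have le_w N : `|fejer M N a| <= w N * `|a|.
  have -> : fejer M N a = M.+1%:R^-1 *: (N.+1%:R^-1 *: \sum_(j < N.+1) F j *: iter j rho a).
    congr (_ *: _); rewrite /avg; under eq_bigr do rewrite -scaler_sumr.
    rewrite -scaler_sumr; congr (_ *: _); under eq_bigr do rewrite exchange_big.
    rewrite exchange_big; apply: eq_bigr => j _; rewrite FE scaler_suml.
    by apply: eq_bigr => k _; rewrite scaler_suml.
  rewrite wE !normrZ !ger0_norm ?invr_ge0// -!mulrA !ler_wpM2l ?invr_ge0//.
  rewrite (le_trans (ler_norm_sum _ _ _))// mulr_suml ler_sum// => j _.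
  rewrite normrZ ger0_norm ?exprn_ge0// ler_wpM2l ?exprn_ge0//.
  by elim: (j : nat) => // i; exact: le_trans (rho_le _).
have w1 : w @ \oo --> (1 : R[i]).
  have -> : (1 : R[i]) = fejer_coef R M 0.
    apply/esym/eqP; rewrite eq_sym -subr_eq0 -normr_le0.
    by have := fejer_coef_dist R M 0; rewrite mulr0.
  apply: (@cvgZr R[i] R[i]).
  apply: (@cvg_sumr R R[i]) => k; apply: (@cvg_sumr R R[i]) => l.
  rewrite addr0; have [->|kl] := eqVneq (k%:Z - l%:Z) 0; last exact: mean_zX_cvg0.
  by under eq_cvg do rewrite expr0z mean1; exact: cvg_cst.
have /cvgrPdist_le/(_ _ ltr01) := w1; apply: filterS => N wN.
rewrite (le_trans (le_w N))// ler_wpM2r//.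
rewrite -[w N]ger0_norm; last first.
  by rewrite wE !mulr_ge0 ?invr_ge0// sumr_ge0// => j _; rewrite exprn_ge0.
rewrite -[w N](subrK 1) (le_trans (ler_normD _ _))// normr1.
by rewrite -[2]/(1 + 1) lerD2r distrC.
Qed.

(** Insertion of [1 = \sum_u u u^*] or [1 = \sum_u u^* u] to the left of [c a]
    shifts the degree by one, so that the means in all degrees are controlled
    by the expectations of the [c a]. *)
Lemma avg_zX_null (m : int) a : (forall c, E (c ** a) = 0) ->
  forall c, (fun N => avg rho (z ^ m) N (c ** a)) @ \oo --> (0 : O).
Proof.
move=> a0.
pose null n := forall c, (fun N => avg rho (z ^ n) N (c ** a)) @ \oo --> (0 : O).
have null0 : null 0.
  by move=> c; rewrite expr0z; have := @expectation_cvg (c ** a); rewrite a0 (star_hom0 piH).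
have step (F : O -> O) (p q : int) :
    (forall u, u \in t -> homogeneous q (F u)) ->
    \sum_(u <- t) F u ** star (F u) = pi 1_X -> null (p + q) -> null p.
  move=> Fq F1 pq c.
  have -> : (fun N => avg rho (z ^ p) N (c ** a)) =
      (fun N => \sum_(u <- t) F u ** avg rho (z ^ (p + q)) N ((star (F u) ** c) ** a)).
    apply/funext => N; rewrite -[in LHS](pi1 c).1 -F1 2!cmul_suml (avg_sum rhoH).
    apply: eq_big_seq => u /Fq uq.
    by rewrite -2!cmulA (avg_mull rhoH _ _ _ uq) -expfzDr ?z_neq0// cmulA.
  have {2}-> : (0 : O) = \sum_(u <- t) F u ** 0.
    by rewrite big1// => u _; rewrite cmul0r.
  apply: (@cvg_sumr R O) => u.
  by apply: (cvg_cmul (f := fun=> F u)); [exact: cvg_cst | exact: pq].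
have up p : null (p + 1) -> null p.
  by apply: (step id) => // u /tT; exact: homogeneous_T.
have down p : null (p - 1) -> null p.
  apply: (step (fun u => star u)); last by under eq_bigr do rewrite starK.
  by move=> u /tT Tu; exact: homogeneous_star (homogeneous_T Tu).
elim/int_rect: m => // n IH; first by apply: down; rewrite -addn1 PoszD addrK.
by apply: up; rewrite -addn1 PoszD opprD subrK.
Qed.

(** The Fejer means of [a] tend to zero with its Fourier coefficients, and those
    of a finite sum [b] of homogeneous elements near [a] are close to [b]. *)
Lemma expectation_faithful a : E (star a ** a) = 0 -> a = 0.
Proof.
move=> /expectation_square_eq0 a0.
apply/eqP; rewrite -normr_eq0 eq_le normr_ge0 andbT.
apply/ler_addgt0Pr => e e0; rewrite add0r.
(* There are five error terms, one of which carries the factor 2 of [fejer_norm_le]. *)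
have e6 : 0 < e / 6 by rewrite divr_gt0.
have [s [d [_ dh]]] := graded_approx a e6; set b := \sum_(m <- s) d m => ab.
pose C : R[i] := \sum_(m <- s) `|m|%N%:R * `|d m|.
have C0 : 0 <= C by rewrite sumr_ge0// => m _; rewrite mulr_ge0.
have [M MC] := filter_ex (near_div_natr_le C0 e6).
pose b' := \sum_(m <- s) fejer_coef R M m *: d m.
have bb' : `|b - b'| <= e / 6.
  rewrite (le_trans _ MC)// /b /b' -sumrB (le_trans (ler_norm_sum _ _ _))//.
  rewrite mulr_sumr ler_sum// => m _.
  rewrite -[X in X - _]scale1r -scalerBl normrZ mulrA ler_wpM2r//.
  exact: fejer_coef_dist.
have fb : fejer M ^~ b @ \oo --> b'.
  under eq_cvg do rewrite fejer_sum.
  by apply: (@cvg_sumr R O) => m; exact: fejer_cvg_homogeneous.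
have fa : fejer M ^~ a @ \oo --> (0 : O).
  have -> : (0 : O) = M.+1%:R^-1 *: \sum_(k < M.+1) \sum_(l < M.+1) 0.
    by rewrite big1 ?scaler0// => k _; rewrite big1.
  apply: cvgZr; apply: (@cvg_sumr R O) => k; apply: (@cvg_sumr R O) => l.
  by have := avg_zX_null (k%:Z - l%:Z) a0 (pi 1_X); rewrite (pi1 a).1.
move/cvgrPdist_le : fb => /(_ _ e6) fb; move/cvgrPdist_le : fa => /(_ _ e6) fa.
have [N [[Nb Na] Nab]] := filter_ex (filterI (filterI fb fa) (fejer_norm_le M (a - b))).
have -> : a = (a - b) + (b - b') + (b' - fejer M N b) - fejer M N (a - b) - (0 - fejer M N a).
  by rewrite fejerB sub0r opprK opprB !addrA !subrK.
have -> : e = e / 6 + e / 6 + e / 6 + 2 * (e / 6) + e / 6 by field.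
rewrite (le_trans (ler_normB _ _))// lerD// (le_trans (ler_normB _ _))// lerD//.
  rewrite (le_trans (ler_normD _ _))// lerD// (le_trans (ler_normD _ _))// lerD//.
by rewrite (le_trans Nab)// ler_wpM2l.
Qed.

Section trace.
Variable x0 : X.
Hypothesis alpha_min : minimal_map alpha.
Notation tr N a := (orbit_mean alpha x0 N (E a)).

(** The elements [a] for which this holds for all [b] form a C*-subalgebra. It
    contains the generators, for which the expectation of the commutator is
    zero or of the form [f - f o alpha]. *)
Lemma commutator_trace_cvg0 a b : (fun N => tr N (a ** b - b ** a)) @ \oo --> (0 : R[i]).
Proof.
pose Z := [set a : O | forall b, (fun N => tr N (a ** b - b ** a)) @ \oo --> (0 : R[i])].
suff ZT : Z = setT by have : Z a by rewrite ZT.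
apply: gen => [|u [[f _ <-]|Tu] c]; last 2 first.
- have -> : (fun N => tr N (pi f ** c - c ** pi f)) = fun=> 0.
    by apply/funext => N; rewrite expectationB expectation_pi_comm subrr orbit_mean0.
  exact: (cvg_cst (0 : R[i])).
- have -> : (fun N => tr N (u ** c - c ** u)) =
      (fun N => orbit_mean alpha x0 N (E (u ** c) - compC alpha (E (u ** c)))).
    by apply/funext => N; rewrite expectationB (expectation_T_comm _ Tu).
  exact: orbit_mean_shift_cvg.
split.
- apply/closed_approx => u uZ b'; apply/cvgrPdist_le => e e0.
  have b1 : 0 < `|b'| *+ 2 + 1 by rewrite ltr_wpDl ?mulrn_wge0.
  have [|v vZ uv] := uZ (e / 2 / (`|b'| *+ 2 + 1)); first by rewrite !divr_gt0.
  have e2 : 0 < e / 2 by rewrite divr_gt0.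
  have /cvgrPdist_le/(_ _ e2) := vZ b'; apply: filterS => N.
  rewrite !sub0r !normrN => vN.
  have -> : u ** b' - b' ** u = (v ** b' - b' ** v) + ((u - v) ** b' - b' ** (u - v)).
    rewrite cmulBl cmulBr opprB addrACA; congr (_ + _); first by rewrite addrC subrK.
    by rewrite addKr.
  rewrite expectationD orbit_meanD (le_trans (ler_normD _ _))// (splitr e) lerD//.
  rewrite (le_trans (orbit_mean_norm_le _ _ _ _))// (le_trans (expectation_norm_le _))//.
  rewrite (le_trans (ler_normB _ _))//.
  rewrite (le_trans (lerD (norm_cmul_le _ _) (norm_cmul_le _ _)))//.
  rewrite [X in _ + X]mulrC -mulr2n -mulrnAr.
  apply: (le_trans (ler_wpM2r _ uv)); first by rewrite mulrn_wge0.
  by rewrite mulrAC -mulrA ler_piMr ?(ltW e2)// ler_pdivrMr// mul1r lerDl.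
- by move=> b'; under eq_cvg do rewrite cmul0l cmul0r subrr expectation0 orbit_mean0; exact: cvg_cst.
- move=> c u v uZ vZ b'.
  have -> : (fun N => tr N ((c *: u + v) ** b' - b' ** (c *: u + v))) =
      (fun N => c * tr N (u ** b' - b' ** u) + tr N (v ** b' - b' ** v)).
    apply/funext => N; rewrite -orbit_meanZ -expectationZ -orbit_meanD -expectationD.
    by rewrite cmulDl cmulDr cmulZl cmulZr scalerBr opprD addrACA.
  have -> : (0 : R[i]) = c * 0 + 0 by rewrite mulr0 addr0.
  by apply: cvgD; [apply: (@cvgZr R[i] R[i]) | ].
- move=> u v uZ vZ b'.
  have -> : (fun N => tr N ((u ** v) ** b' - b' ** (u ** v))) =
      (fun N => tr N (u ** (v ** b') - (v ** b') ** u) + tr N (v ** (b' ** u) - (b' ** u) ** v)).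
    by apply/funext => N; rewrite -orbit_meanD -expectationD !cmulA addrA subrK.
  have -> : (0 : R[i]) = 0 + 0 by rewrite addr0.
  by apply: cvgD.
- move=> u uZ b'.
  have -> : (fun N => tr N (star u ** b' - b' ** star u)) =
      (fun N => - (tr N (u ** star b' - star b' ** u))^*).
    apply/funext => N; rewrite -orbit_mean_star -expectation_star starB !starM starK.
    by rewrite !expectationB !orbit_meanB opprB.
  have -> : (0 : R[i]) = - 0^* by rewrite rmorph0 oppr0.
  apply: (@cvgN R[i] R[i]).
  pose f N := tr N (u ** star b' - star b' ** u).
  exact: (@continuous_cvg nat _ _ \oo _ f (fun w : R[i] => w^*) 0
    (@conj_continuous R 0) (uZ (star b'))).
Qed.

Lemma squares_commutators_eq0 (I J : finType) (p : I -> O) (v : J -> O) :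
  \sum_i star (p i) ** p i = \sum_j (star (v j) ** v j - v j ** star (v j)) ->
  forall i, p i = 0.
Proof.
move=> pv i; apply: expectation_faithful.
apply: (orbit_mean_faithful alpha_min (x0 := x0)) => [x|]; first exact: expectation_square_ge0.
have pm : (fun N => tr N (\sum_i star (p i) ** p i)) @ \oo --> (0 : R[i]).
  under eq_cvg do rewrite pv expectation_sum orbit_mean_sum.
  have {2}-> : (0 : R[i]) = \sum_(j : J) 0 by rewrite big1.
  by apply: (@cvg_sumr R R[i]) => j; exact: commutator_trace_cvg0.
apply/cvgrPdist_le => e e0; move/cvgrPdist_le: pm => /(_ _ e0).
apply: filterS => N; rewrite !sub0r !normrN => pN.
have tr0 k : 0 <= tr N (star (p k) ** p k).
  by rewrite mulr_ge0 ?invr_ge0// sumr_ge0// => j _; exact: expectation_square_ge0.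
rewrite ger0_norm// (le_trans _ pN)//.
rewrite expectation_sum orbit_mean_sum ger0_norm ?sumr_ge0//.
by rewrite (bigD1 i)//= lerDl sumr_ge0.
Qed.

End trace.

End expectation.

(** * Matrices over a C*-algebra *)

Section matrices.
Variables (R : realType) (A : cstarAlgType R) (e : A).
Hypothesis eP : is_identity e.
Variable n : nat.
Implicit Types u v w : 'M[A]_n.

Lemma mxcmulA u v w : mxcmul u (mxcmul v w) = mxcmul (mxcmul u v) w.
Proof.
apply/matrixP => i j; rewrite !mxE.
under eq_bigr do rewrite mxE cmul_sumr.
under [RHS]eq_bigr do rewrite mxE cmul_suml.
rewrite exchange_big; apply: eq_bigr => k _; apply: eq_bigr => l _.
exact: cmulA.
Qed.

Lemma mxcmulBl u v w : mxcmul (u - v) w = mxcmul u w - mxcmul v w.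
Proof.
apply/matrixP => i j; rewrite !mxE -sumrB; apply: eq_bigr => k _.
by rewrite !mxE cmulBl.
Qed.

Lemma mxcmulBr u v w : mxcmul w (u - v) = mxcmul w u - mxcmul w v.
Proof.
apply/matrixP => i j; rewrite !mxE -sumrB; apply: eq_bigr => k _.
by rewrite !mxE cmulBr.
Qed.

Lemma mxcmul1l u : mxcmul (mxidentity n e) u = u.
Proof.
apply/matrixP => i j; rewrite !mxE (bigD1 i)//= mxE eqxx (eP _).1 big1 ?addr0// => k ki.
by rewrite mxE eq_sym (negPf ki) cmul0l.
Qed.

Lemma mxcmul1r u : mxcmul u (mxidentity n e) = u.
Proof.
apply/matrixP => i j; rewrite !mxE (bigD1 j)//= mxE eqxx (eP _).2 big1 ?addr0// => k ki.
by rewrite mxE (negPf ki) cmul0r.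
Qed.

Lemma mxstarM u v : mxstar (mxcmul u v) = mxcmul (mxstar v) (mxstar u).
Proof.
apply/matrixP => i j; rewrite !mxE star_sum; apply: eq_bigr => k _.
by rewrite !mxE starM.
Qed.

Lemma mxstarK u : mxstar (mxstar u) = u.
Proof. by apply/matrixP => i j; rewrite !mxE starK. Qed.

Lemma mxstarB u v : mxstar (u - v) = mxstar u - mxstar v.
Proof. by apply/matrixP => i j; rewrite !mxE starB. Qed.

Lemma mxstar1 : mxstar (mxidentity n e) = mxidentity n e.
Proof.
apply/matrixP => i j; rewrite !mxE eq_sym; case: eqVneq => _.
  exact: identity_star.
exact: star0.
Qed.

End matrices.

(** For an isometry [v], [q = 1 - v v^*] is a projection, and the diagonal
    entries of [q = q^* q] add up to commutators. *)
Lemma stably_finite_of_traces (R : realType) (A : cstarAlgType R) (e : A) :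
  is_identity e ->
  (forall (I J : finType) (p : I -> A) (v : J -> A),
    \sum_i star (p i) ** p i = \sum_j (star (v j) ** v j - v j ** star (v j)) ->
    forall i, p i = 0) ->
  stably_finite A.
Proof.
move=> eP tr0; exists e => // n v vv; pose w := mxcmul v (mxstar v).
pose q := mxidentity n e - w.
have qs : mxstar q = q by rewrite /q mxstarB mxstar1// /w mxstarM mxstarK.
have ww : mxcmul w w = w by rewrite /w mxcmulA -[mxcmul (mxcmul v _) v]mxcmulA vv mxcmul1r.
have qq : mxcmul (mxstar q) q = q.
  by rewrite qs {1}/q mxcmulBl mxcmul1l// /q mxcmulBr mxcmul1r// ww subrr subr0.
have q0 i j : q i j = 0.
  have := tr0 ('I_n * 'I_n)%type ('I_n * 'I_n)%type (fun p => q p.1 p.2) (fun p => v p.1 p.2).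
  move=> /(_ _ (i, j)); apply.
  have pairE (F : 'I_n -> 'I_n -> A) : \sum_p F p.1 p.2 = \sum_i \sum_j F i j.
    by rewrite pair_bigA.
  rewrite sumrB (pairE (fun i j => star (q i j) ** q i j)).
  rewrite (pairE (fun i j => star (v i j) ** v i j)) (pairE (fun i j => v i j ** star (v i j))).
  rewrite [LHS]exchange_big [X in _ = X - _]exchange_big/= -sumrB; apply: eq_bigr => k _.
  have entryE (u : 'M[A]_n) : \sum_l star (u l k) ** u l k = mxcmul (mxstar u) u k k.
    by rewrite mxE; apply: eq_bigr => l _; rewrite mxE.
  rewrite !entryE qq vv.
  by rewrite /q /w !mxE; congr (_ - _); apply: eq_bigr => l _; rewrite mxE.
by apply/eqP; rewrite eq_sym -subr_eq0; apply/eqP/matrixP => i j; rewrite q0 mxE.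
Qed.

Section rotation.
Variable R : realType.

(** The powers of [3 + 4i] are congruent to [3 + 4i] modulo 5. *)
Lemma exists_free_unit_complex :
  exists2 z : R[i], `|z| = 1 & forall m : int, z ^ m = 1 -> m = 0.
Proof.
pose w : R[i] := (3 +i* 4)%C; pose z := w / 5.
have wX n : exists a b : int, w ^+ n.+1 = ((5 * a + 3)%:~R +i* (5 * b + 4)%:~R)%C.
  elim: n => [|n [a [b IH]]].
    by exists 0, 0; rewrite expr1 mulr0 !add0r.
  exists (3 * a - 4 * b - 2), (4 * a + 3 * b + 4).
  rewrite exprS IH /w; simpc; congr (_ +i* _)%C; rewrite !(rmorphD, rmorphM, rmorphN)/=; ring.
have zX n : z ^+ n = 1 -> n = 0%N.
  case: n => // n zn; have [a [b wab]] := wX n.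
  have : w ^+ n.+1 = 5 ^+ n.+1.
    by rewrite -(mulfVK (x := 5) _ w) ?pnatr_eq0// exprMn zn mul1r.
  rewrite wab -natrX => /(congr1 (@complex.Im R))/=.
  have -> : complex.Im ((5 ^ n.+1)%:R : R[i]) = 0.
    by rewrite -(rmorph_nat (real_complex R)).
  by move/eqP; rewrite intr_eq0; lia.
exists z => [|m zm].
  rewrite normrM normfV normr_nat normc_def/=.
  have -> : (3 : R) ^+ 2 + 4 ^+ 2 = 5 ^+ 2 by ring.
  by rewrite sqrtr_sqr normr_nat rmorph_nat mulfV// pnatr_eq0.
case: m zm => n zn; first by rewrite (zX n zn).
have : z ^+ n.+1 = 1 by rewrite -[z ^+ _]invrK [X in X^-1]zn invr1.
by move/zX.
Qed.

End rotation.

(** * The Cuntz-Pimsner algebra of a line bundle *)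

Section cuntz_pimsner_bundle.
Variables (R : realType) (X : metricType R) (cptX : compact [set: X]).
Variables (V : lineBundle R X) (alpha : homeomorphism X).
Notation CX := (contC R cptX).
Notation Gam := (twisted_sections cptX V alpha).
Notation "1_X" := (constC cptX 1).

Definition inverse_homeomorphism : homeomorphism X :=
  Homeomorphism (@homeo_inv_continuous _ alpha) (@homeo_continuous _ alpha)
    (@homeo_invK _ alpha) (@homeo_funK _ alpha).

Lemma lact_ract f (xi : Gam) : lact f xi = ract xi (compC alpha f).
Proof. by apply: sectionP => x. Qed.

(** The left action is faithful, and the frame writes it as a sum of operators [theta]. *)
Lemma katsura_ideal_full (f : CX) : katsura_ideal Gam f.
Proof.
split=> [|b b0]; last first.
  suff -> : b = 0 by rewrite cmul0r.
  apply: contC_eqP => y; rewrite -(homeo_invK alpha y).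
  set x := homeo_inv alpha y; have [xi xi0] := exists_nonvanishing_section cptX V x.
  have := congr1 (fun eta : sections cptX V => eta x) (b0 xi).
  rewrite twisted_sections_lactE sec0E => /eqP; rewrite scaler_eq0 (negPf xi0) orbF.
  by move/eqP.
split; first by exists (lact (star f)); exact: lact_star.
have [s s1] := exists_frame cptX V.
move=> e e0; exists [seq (ract eta (compC alpha f), eta) | eta <- s] => zeta.
have lactE : lact f zeta = \sum_(eta <- s) theta (ract eta (compC alpha f)) eta zeta.
  apply: sectionP => x.
  rewrite (big_morph (fun xi : sections cptX V => xi x) (id1 := 0) (op1 := +%R))//.
  rewrite twisted_sections_lactE {1}(frame_expansion zeta s1).
  rewrite (big_morph (fun xi : sections cptX V => xi x) (id1 := 0) (op1 := +%R))//.
  rewrite scaler_sumr; apply: eq_bigr => eta _.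
  rewrite /theta !sections_ractE !scalerA; congr (_ *: _); exact: mulrC.
by rewrite big_map -lactE subrr normr0 mulr_ge0// lecR ltW.
Qed.

Variables (O : cstarAlgType R) (pi : CX -> O) (tau : Gam -> O).
Hypothesis cpO : cuntz_pimsner pi tau.

Let cov := cp_covariant cpO.
Let piH : star_hom pi := covariant_pi cov.

(** The difference [d] of the two sides satisfies [d^* d = 0]. *)
Lemma tau_ract xi f : tau (ract xi f) = tau xi ** pi f.
Proof.
have ipE := covariant_ip cov.
apply/eqP; rewrite -subr_eq0; apply/eqP/cstar_eq0.
rewrite starB starM cmulBl !cmulBr -!cmulA [star (tau xi) ** (_ ** _)]cmulA.
rewrite [star (tau _) ** (tau xi ** _)]cmulA -!ipE -(star_homV piH) -!(star_homM piH).
rewrite -!ip_ract.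
have -> : star f ** ip xi (ract xi f) = ip (ract xi f) (ract xi f) :> CX.
  by rewrite -[RHS]star_ip [in RHS]ip_ract starM star_ip.
by rewrite !subrr.
Qed.

Lemma pi_identity : is_identity (pi 1_X).
Proof.
pose L := [set a : O | pi 1_X ** a = a /\ a ** pi 1_X = a].
suff LT : L = setT by move=> a; have : L a by rewrite LT.
have ract1 (xi : Gam) : ract xi (1_X : CX) = xi.
  by apply: sectionP => x; rewrite sections_ractE; exact: scale1r.
apply: (cp_generates cpO) => [|a [[f _ <-]|[xi _ <-]]]; last 2 first.
- by rewrite /L/= -!(star_homM piH) (constC_identity f).1 (constC_identity f).2.
- rewrite /L/= (covariant_lact cov) lact_ract -tau_ract ract1; split=> //.
  by rewrite -[in RHS](ract1 xi); congr (tau (ract xi _)); apply: contC_eqP.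
split.
- pose p := pi 1_X; have p1 : 0 < `|p| + 1 by rewrite ltr_wpDl.
  apply/closed_approx => a aL.
  have close (F : O -> O) : (forall b c, F (b - c) = F b - F c) ->
      (forall b, `|F b| <= `|p| * `|b|) -> (forall b, L b -> F b = b) -> F a = a.
    move=> FB Fp FL; apply/eqP; rewrite -subr_eq0 -normr_le0.
    apply/ler_addgt0Pr => e e0; rewrite add0r.
    have [|b Lb ab] := aL (e / (`|p| + 1)); first by rewrite divr_gt0.
    have -> : F a - a = F (a - b) - (a - b) by rewrite FB (FL b Lb) opprB addrA subrK.
    rewrite (le_trans (ler_normB _ _))// (le_trans (lerD (Fp _) (lexx _)))//.
    rewrite -[X in _ + X]mul1r -mulrDl (le_trans (ler_wpM2l (ltW p1) ab))//.
    by rewrite mulrC mulfVK// gt_eqF.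
  split.
    apply: (close (fun b => p ** b)) => [b c|b|b []//]; first exact: cmulBr.
    exact: norm_cmul_le.
  apply: (close (fun b => b ** p)) => [b c|b|b []//]; first exact: cmulBl.
  by rewrite mulrC; exact: norm_cmul_le.
- by rewrite /L/= cmul0l cmul0r.
- by move=> c a b [a1 a2] [b1 b2]; rewrite /L/= cmulDl cmulDr cmulZl cmulZr a1 a2 b1 b2.
- by move=> a b [a1 a2] [b1 b2]; rewrite /L/= cmulA a1 -cmulA b2.
- move=> a [a1 a2]; have s1 : star (pi 1_X) = pi 1_X.
    by rewrite -(star_homV piH) (identity_star (@constC_identity R X cptX)).
  by rewrite /L/= -s1 -!starM a1 a2.
Qed.

(** Covariance at the function whose left action is [theta xi eta]. *)
Lemma tau_star_tau xi eta :
  tau xi ** star (tau eta) = pi (compC inverse_homeomorphism (ip eta xi)).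
Proof.
have [psi [_ psi_theta psi_lact]] := covariant_katsura cov.
rewrite -psi_theta (psi_lact _ (katsura_ideal_full _)); congr psi.
by apply: theta_lact => x; exact: (congr1 (ip eta xi : CX) (homeo_funK alpha x)).
Qed.

(** The products [tau xi (tau eta)^*], hence the map [psi], are unchanged by the factor [z]. *)
Lemma gauge_endomorphism (z : R[i]) : `|z| = 1 -> exists rho : O -> O,
  [/\ star_hom rho, rho \o pi = pi & rho \o tau = (fun xi => z *: tau xi)].
Proof.
move=> z1; apply: (cp_universal cpO).
have zz : z * z^* = 1 by rewrite -normCK z1 expr1n.
have [psi [psiH psi_theta psi_lact]] := covariant_katsura cov.
split.
- exact: piH.
- move=> c xi eta; have tl : tau (c *: xi + eta) = c *: tau xi + tau eta.
    exact: (covariant_tau cov).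
  by rewrite tl scalerDr !scalerA [z * c]mulrC.
- move=> xi eta; rewrite starZ cmulZl cmulZr scalerA mulrC zz scale1r.
  exact: covariant_ip cov _ _.
- by move=> f xi; rewrite cmulZr (covariant_lact cov).
- exists psi; split=> // xi eta; rewrite psi_theta.
  by rewrite starZ cmulZl cmulZr scalerA zz scale1r.
Qed.

Lemma stably_finite_cuntz_pimsner (x0 : X) : minimal_map alpha -> stably_finite O.
Proof.
move=> amin; have tauT xi : range tau (tau xi) by exists xi.
have [s s1] := exists_frame cptX V.
pose t := [seq tau xi | xi <- s].
have tT u : u \in t -> range tau u by move=> /mapP[xi _ ->].
have t_iso : \sum_(u <- t) star u ** u = pi 1_X.
  rewrite big_map -s1 (star_hom_sum piH); apply: eq_bigr => xi _.
  by rewrite (covariant_ip cov).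
have t_coiso : \sum_(u <- t) u ** star u = pi 1_X.
  rewrite big_map.
  transitivity (pi (\sum_(xi <- s) compC inverse_homeomorphism (ip xi xi))).
    by rewrite (star_hom_sum piH); apply: eq_bigr => xi _; exact: tau_star_tau.
  congr pi; apply: contC_eqP => x; rewrite contC_sumE.
  by have := congr1 (fun f : CX => f (homeo_inv alpha x)) s1; rewrite contC_sumE.
have T_lact f u : range tau u -> pi f ** u = u ** pi (compC alpha f).
  by move=> [xi _ <-]; rewrite (covariant_lact cov) lact_ract tau_ract.
(* Otherwise [pi] kills a sum of squares without zeros, hence the identity. *)
have [inj|ninj] := pselect (forall h, pi h = 0 -> h = 0); last first.
  have pi0 : pi 1_X = 0.
    move/existsNP : ninj => [h /not_implyP[h0 /eqP hn]].
    have [r rP] := minimal_finite_cover amin hn.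
    pose F k := iter k (compC alpha) h.
    have F0 k : pi (F k) = 0.
      elim: k => //= k IH; rewrite -(frame_conj_pi pi_identity T_lact tT t_iso) IH.
      by rewrite big1// => u _; rewrite cmul0r cmul0l.
    pose G : CX := \sum_(k <- r) star (F k) ** F k.
    have sq0 k x : 0 <= (star (F k) ** F k) x.
      by rewrite contC_mulE contC_starE -normCKC exprn_ge0.
    have G0 x : G x != 0.
      rewrite contC_sumE psumr_neq0//; apply: sub_has (rP x) => k hk /=.
      rewrite lt_def sq0 andbT contC_mulE contC_starE -normCKC expf_eq0/=.
      by rewrite normr_eq0 iter_compCE.
    have [q qE] := contC_inverse G0.
    have -> : 1_X = q ** G.
      by apply: contC_eqP => x; rewrite contC_mulE qE mulVf.
    rewrite (star_homM piH) (star_hom_sum piH) big1 ?cmul0r// => k _.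
    by rewrite (star_homM piH) F0 cmul0r.
  have all0 (a : O) : a = 0 by rewrite -[a](pi_identity a).1 pi0 cmul0l.
  exists 0 => [a|n v _]; first by rewrite [a]all0 cmul0l.
  by apply/matrixP => i j; rewrite [LHS]all0 [RHS]all0.
have iso := injective_isometry piH inj.
have [z z1 zfree] := exists_free_unit_complex R.
have [rho [rhoH rho_pi rho_tau]] := gauge_endomorphism z1.
apply: (stably_finite_of_traces pi_identity) => I J p v pv.
apply: (squares_commutators_eq0 piH pi_identity iso T_lact _ _ _ _ (cp_generates cpO)
  tT t_coiso t_iso rhoH _ _ z1 zfree x0 amin pv).
- by move=> f _ [xi _ <-]; rewrite (covariant_lact cov).
- by move=> _ f [xi _ <-]; rewrite -tau_ract.
- by move=> _ _ [xi _ <-] [eta _ <-]; exists (ip xi eta); rewrite // (covariant_ip cov).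
- by move=> _ _ [xi _ <-] [eta _ <-]; rewrite tau_star_tau; exists (compC inverse_homeomorphism (ip eta xi)).
- by move=> f; rewrite -[in RHS]rho_pi.
- by move=> _ [xi _ <-]; rewrite -[LHS]/((rho \o tau) xi) rho_tau.
Qed.

End cuntz_pimsner_bundle.

Theorem corollary4p6 (R : realType) (X : metricType R)
    (cptX : compact [set: X]) (infX : infinite_set [set: X])
    (V : lineBundle R X)
    (alpha : homeomorphism X) (min_alpha : minimal_map alpha)
    (O : cstarAlgType R) (pi : contC R cptX -> O)
    (tau : twisted_sections cptX V alpha -> O)
    (cpO : @cuntz_pimsner R (contC R cptX) (twisted_sections cptX V alpha)
             O pi tau) :
  stably_finite O.

Proof.
have [x0 _] := infinite_setN0 infX.
exact: stably_finite_cuntz_pimsner cpO x0 min_alpha.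
Qed.
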